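(* Let $B$ be a unital algebra over $\mathbb C$. Then, with the half-shuffle products $\prec,\succ$ and the convolution product $\star$ described in the context, $\big(\overline{\mathrm{Hom}}(T(\mathcal{NC}),T(\mathrm{Hom}(B))),\prec,\succ,\star\big)$ is a shuffle algebra (augmented by the unit $\eta_{\mathrm{Hom}(B)}\circ\varepsilon$).
   Context: All vector spaces are over $\mathbb C$. A bicollection is a family $P=(P(n,m))_{n,m\ge 0}$ of vector spaces ($n$ outputs, $m$ inputs); morphisms of bicollections are families of linear maps; the set of morphisms is denoted $\mathrm{Hom}_{\mathrm{Coll}_2}$. Vertical tensor product: $(P\boxtimes Q)(n,m)=\bigoplus_{k\ge 0}P(n,k)\otimes Q(k,m)$, with unit $\mathbf 1_v$ ($\mathbf 1_v(n,n)=\mathbb C1_n$, zero for $n\neq m$). For a family $(P(n))_{n\ge1}$ of vector spaces (a collection), $T(P)$ is the bicollection of words: $T(P)(0,0)=\mathbb C1$ and $T(P)(n,m)=\bigoplus_{k_1+\cdots+k_n=m}P(k_1)\otimes\cdots\otimes P(k_n)$ otherwise. Concatenation maps are denoted by juxtaposition; on $T(P)\boxtimes T(P)$ one sets $(a\boxtimes b)(a'\boxtimes b')=aa'\boxtimes bb'$. A morphism of bicollections compatible with these products and units is called a horizontal algebra morphism; $\mathbf 1_v$ has horizontal product $1_n1_m=1_{n+m}$. If $P$ is an operad (non-symmetric), with $|p|=k$ for $p\in P(k)$, the vertical product $\nabla:T(P)\boxtimes T(P)\to T(P)$ sends $(p^1\cdots p^n)\boxtimes(q_1\cdots q_N)$,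 $N=\sum_i|p^i|$, to the word whose $i$-th letter is $p^i$ composed with its consecutive group of $|p^i|$ letters $q_j$. $\mathrm{Hom}(B)$ is the operad $\mathrm{Hom}(B)(n)=\mathrm{Hom}(B^{\otimes n},B)$, $n\ge1$, with usual composition of multilinear maps; $\nabla_{\mathrm{Hom}(B)}$ is the induced vertical product on $T(\mathrm{Hom}(B))$, and $\eta_{\mathrm{Hom}(B)}:\mathbf 1_v\to T(\mathrm{Hom}(B))$ is $1_n\mapsto\mathrm{id}_B^{\,n}$ (word of length $n$). $\mathrm{NC}(n)$ is the set of non-crossing partitions of $\{1,\dots,n\}$, $\mathrm{NC}(0)=\{\emptyset\}$; $\mathcal{NC}(n)$ is the vector space spanned by $\mathrm{NC}(n-1)$, $n\ge1$. A partition of $p$ elements has $p+1$ inputs, its gaps (before $1$, between consecutive elements, after $p$); $\pi\circ(\alpha_1,\dots,\alpha_{|\pi|})$ is obtained by inserting $\alpha_i$ in the $i$-th gap of $\pi$. The counit $\varepsilon:T(\mathcal{NC})\to\mathbf 1_v$ is the horizontal algebra morphism with $\varepsilon(\emptyset)=1_1$, $\varepsilon(\pi)=0$ for $\pi\neq\emptyset$. A block $W$ is nested in a block $V\ne W$ of $\pi$ if $W\subset\{\min V,\dots,\max V\}$. A lowerset of $\pi$ is a (possibly empty) set $L$ of blocks such that if $V\in L$ then all blocks in which $V$ is nested are in $L$. If $L$ partitions $p$ elements it is identified (after renumbering) with an element of $\mathrm{NC}(p)$; the remaining blocks lie in the gaps of $L$ and give a word $U=U_0\cdots U_p$ of (possibly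 empty) non-crossing partitions with $\pi=L\circ(U_0,\dots,U_p)$. The pair $(L,U)$ is a cut of $\pi$; $1\in L$ means that the block containing $1$ is in $L$, $1\in U$ that it is not. The coproduct $\Delta$ is the horizontal algebra morphism $T(\mathcal{NC})\to T(\mathcal{NC})\boxtimes T(\mathcal{NC})$ with $\Delta(\pi)=\sum_{(L,U)\in cut(\pi)}L\boxtimes U$. Let $T^+(\mathcal{NC})=\bigoplus_{n\ne m}T(\mathcal{NC})(n,m)$, spanned by words with at least one non-empty letter. For non-empty $\pi$, $\Delta^+_\prec(\pi)=\sum_{1\in L}L\boxtimes U$, $\Delta^+_\succ(\pi)=\sum_{1\in U}L\boxtimes U$, extended to $T^+(\mathcal{NC})$ by $\Delta^+_\bullet(\emptyset^q\,\pi\,w)=(\emptyset^q\boxtimes\emptyset^q)\Delta^+_\bullet(\pi)\Delta(w)$ for $\pi\neq\emptyset$ and any word $w$; then $\Delta_\prec(w)=\Delta^+_\prec(w)-w\boxtimes\emptyset^m$, $\Delta_\succ(w)=\Delta^+_\succ(w)-\emptyset^n\boxtimes w$ for $w\in T^+(\mathcal{NC})(n,m)$. $\overline{\mathrm{Hom}}(T(\mathcal{NC}),T(\mathrm{Hom}(B)))=\mathbb C(\eta_{\mathrm{Hom}(B)}\circ\varepsilon)\oplus\mathrm{Hom}_{\mathrm{Coll}_2}(T^+(\mathcal{NC}),T(\mathrm{Hom}(B)))$ (morphisms on $T^+$ being extended by zero). For $f,g\in\mathrm{Hom}_{\mathrm{Coll}_2}(T^+(\mathcal{NC}),T(\mathrm{Hom}(B)))$: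 $f\prec g=\nabla_{\mathrm{Hom}(B)}\circ(f\boxtimes g)\circ\Delta_\prec$, $f\succ g=\nabla_{\mathrm{Hom}(B)}\circ(f\boxtimes g)\circ\Delta_\succ$; with $e=\eta_{\mathrm{Hom}(B)}\circ\varepsilon$ set $f\prec e=e\succ f=f$ and $e\prec f=f\succ e=0$. The convolution product is $f\star g=\nabla_{\mathrm{Hom}(B)}\circ(f\boxtimes g)\circ\Delta$. A shuffle algebra is a vector space $D$ with bilinear products $\prec,\succ$ satisfying $(a\prec b)\prec c=a\prec(b\prec c+b\succ c)$, $(a\succ b)\prec c=a\succ(b\prec c)$, $a\succ(b\succ c)=(a\succ b+a\prec b)\succ c$; its associative product is $a\prec b+a\succ b$. Its augmentation is $D\oplus\mathbb C\mathbf 1$ with $a\prec\mathbf 1=a=\mathbf 1\succ a$, $\mathbf 1\prec a=0=a\succ\mathbf 1$ for $a\in D$, and $\mathbf 1$ the unit of the associative product ($\mathbf 1\prec\mathbf 1$ and $\mathbf 1\succ\mathbf 1$ are left undefined). The statement is thus that $D=\mathrm{Hom}_{\mathrm{Coll}_2}(T^+(\mathcal{NC}),T(\mathrm{Hom}(B)))$ is a shuffle algebra, with augmentation by $\mathbf 1=e$, and that its associative product is $\star$. *)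

(* Defs.v *)
From HB Require Import structures.
From mathcomp Require Import all_boot all_order all_algebra.
From mathcomp Require Import boolp functions reals complex.
From mathcomp Require Import generic_quotient ring_quotient freeg.

Set Implicit Arguments.
Unset Strict Implicit.
Unset Printing Implicit Defensive.

Import Order.TTheory GRing.Theory.
Local Open Scope ring_scope.
Local Open Scope quotient_scope.

Section Presented.
Variables (K : fieldType) (X : choiceType) (rel : {freeg X / K} -> Prop).
Local Notation F := {freeg X / K}.

Definition subspace (S : F -> Prop) : Prop :=
  S 0 /\ forall a x y, S x -> S y -> S (a *: x + y).

Definition relspan : {pred F} :=
  fun x => `[< forall S, subspace S -> (forall r, rel r -> S r) -> S x >].

Lemma relspanP x : reflect
  (forall S, subspace S -> (forall r, rel r -> S r) -> S x) (x \in relspan).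
Proof. exact: asboolP. Qed.

Lemma relspan_lin a x y :
  x \in relspan -> y \in relspan -> a *: x + y \in relspan.
Proof.
move=> /relspanP hx /relspanP hy; apply/relspanP => S sS rS.
by apply: sS.2; [exact: hx | exact: hy].
Qed.

Lemma relspan_zmod : zmod_closed relspan.
Proof.
have h0 : 0 \in relspan by apply/relspanP => S [].
split=> // x y hx hy; rewrite addrC -scaleN1r; exact: relspan_lin.
Qed.

HB.instance Definition _ := GRing.isZmodClosed.Build F relspan relspan_zmod.

Definition presented := Quotient.quot relspan.

HB.instance Definition _ := GRing.Zmodule.on presented.
HB.instance Definition _ := Quotient.on presented.

Lemma presented_eq (x y : F) :
  (\pi_presented x = \pi_presented y) <-> (x - y \in relspan).
Proof.
rewrite Quotient.idealrBE; split=> [h|/eqP //]; exact/eqP.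
Qed.

Lemma presented_piD (x y : F) :
  \pi_presented (x + y) = \pi_presented x + \pi_presented y.
Proof. exact: (@Quotient.pi_add _ relspan). Qed.

Definition presented_scale (a : K) (q : presented) : presented :=
  \pi_presented (a *: repr q).

Lemma presented_piZ a (x : F) :
  \pi_presented (a *: x) = presented_scale a (\pi_presented x).
Proof.
apply/presented_eq; rewrite -scalerBr -[X in X \in _]addr0.
apply: relspan_lin; last exact: rpred0.
by apply/presented_eq; rewrite reprK.
Qed.

Fact presented_scaleA a b v :
  presented_scale a (presented_scale b v) = presented_scale (a * b) v.
Proof.
by rewrite -[v]reprK -(presented_piZ b) -(presented_piZ a) -presented_piZ scalerA.
Qed.
Fact presented_scale1 : left_id 1 presented_scale.
Proof. by move=> v; rewrite -[v]reprK -presented_piZ scale1r. Qed.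
Fact presented_scaleDr : right_distributive presented_scale +%R.
Proof.
move=> a u v; rewrite -[u]reprK -[v]reprK.
by rewrite -presented_piD -!(presented_piZ a) -presented_piD scalerDr.
Qed.
Fact presented_scaleDl v : {morph presented_scale^~ v : a b / a + b}.
Proof.
move=> a b; rewrite -[v]reprK -(presented_piZ a) -(presented_piZ b).
by rewrite -presented_piZ -presented_piD scalerDl.
Qed.

HB.instance Definition _ := GRing.Zmodule_isLmodule.Build K presented
  presented_scaleA presented_scale1 presented_scaleDr presented_scaleDl.

Lemma pi_presented_linear : linear \pi_presented.
Proof. by move=> a x y; rewrite presented_piD presented_piZ. Qed.

Definition gen (x : X) : presented := \pi_presented << x >>.

Section Lift.
Variables (V : lmodType K) (phi : X -> V).
Hypothesis phi_rel : forall r, rel r -> fglift phi r = 0.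

HB.instance Definition _ := GRing.isZmodMorphism.Build F V (fglift phi)
  (lift_is_additive phi).

Lemma fglift_linear : linear (fglift phi).
Proof.
have fgD : {morph fglift phi : x y / x + y} by exact: raddfD.
have fgS (I : Type) (r : seq I) (G : I -> F) :
    fglift phi (\sum_(i <- r) G i) = \sum_(i <- r) fglift phi (G i).
  exact: raddf_sum.
move=> a x y; rewrite fgD; congr (_ + _).
have -> : a *: x = \sum_(i <- dom x) << a * coeff i x *g i >> by [].
rewrite -[in RHS](freeg_sumE x) !fgS scaler_sumr.
by apply: eq_bigr => i _; rewrite !liftU scalerA.
Qed.

Lemma fgliftE x : fglift phi x = \sum_(i <- dom x) coeff i x *: phi i.
Proof.
have fgS (I : Type) (r : seq I) (G : I -> F) :
    fglift phi (\sum_(i <- r) G i) = \sum_(i <- r) fglift phi (G i).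
  exact: raddf_sum.
rewrite -[LHS](congr1 (fglift phi) (freeg_sumE x)) fgS.
by apply: eq_bigr => i _; rewrite liftU.
Qed.

Lemma fglift_relspan x : x \in relspan -> fglift phi x = 0.
Proof.
move=> /relspanP hx; apply: (hx (fun x => fglift phi x = 0)) => //.
split; first exact: raddf0.
by move=> a u v hu hv; rewrite fglift_linear hu hv scaler0 addr0.
Qed.

Definition lift_presented (q : presented) : V := fglift phi (repr q).

Lemma lift_presented_pi x : lift_presented (\pi_presented x) = fglift phi x.
Proof.
apply/eqP; rewrite -subr_eq0 -raddfB; apply/eqP/fglift_relspan.
by apply/presented_eq; rewrite reprK.
Qed.

Lemma lift_presented_gen x : lift_presented (gen x) = phi x.
Proof. by rewrite lift_presented_pi liftU scale1r. Qed.

Lemma lift_presented_linear : linear lift_presented.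
Proof.
move=> a u v; rewrite -[u]reprK -[v]reprK -pi_presented_linear.
by rewrite !lift_presented_pi fglift_linear.
Qed.
End Lift.
End Presented.

Definition bicollection (K : fieldType) := nat -> nat -> lmodType K.

Section Hom2.
Variable K : fieldType.
Implicit Types P Q S : bicollection K.

Record hom2 P Q := Hom2 {
  hom2_fun :> forall n m, P n m -> Q n m;
  hom2_linear : forall n m, linear (@hom2_fun n m)
}.
Arguments hom2_fun [P Q] h n m x : rename.

HB.instance Definition _ P Q (f : hom2 P Q) n m :=
  GRing.isLinear.Build K (P n m) (Q n m) _ (f n m) (@hom2_linear _ _ f n m).

Lemma hom2P P Q (f g : hom2 P Q) : (forall n m, f n m =1 g n m) -> f = g.
Proof.
case: f g => f hf [g hg] /= e.
have {}e : f = g by do 3![apply/functional_extensionality_dep => ?]; exact: e.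
by case: g / e hg => hg; congr Hom2; exact: Prop_irrelevance.
Qed.

HB.instance Definition _ P Q := gen_eqMixin (hom2 P Q).
HB.instance Definition _ P Q := gen_choiceMixin (hom2 P Q).

Fact hom2_zero_linear P Q n m : linear (fun _ : P n m => 0 : Q n m).
Proof. by move=> a x y; rewrite scaler0 addr0. Qed.
Fact hom2_opp_linear P Q (f : hom2 P Q) n m : linear (fun x => - f n m x).
Proof. by move=> a x y; rewrite linearP opprD scalerN. Qed.
Fact hom2_add_linear P Q (f g : hom2 P Q) n m :
  linear (fun x => f n m x + g n m x).
Proof. by move=> a x y; rewrite !linearP scalerDr addrACA. Qed.
Fact hom2_scale_linear P Q (c : K) (f : hom2 P Q) n m :
  linear (fun x => c *: f n m x).
Proof. by move=> a x y; rewrite linearP scalerDr !scalerA mulrC. Qed.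

Definition hom2_zero P Q := Hom2 (@hom2_zero_linear P Q).
Definition hom2_opp P Q (f : hom2 P Q) := Hom2 (hom2_opp_linear f).
Definition hom2_add P Q (f g : hom2 P Q) := Hom2 (hom2_add_linear f g).
Definition hom2_scale P Q (c : K) (f : hom2 P Q) :=
  Hom2 (hom2_scale_linear c f).

Fact hom2_addA P Q : associative (@hom2_add P Q).
Proof. by move=> f g h; apply: hom2P => n m x /=; rewrite addrA. Qed.
Fact hom2_addC P Q : commutative (@hom2_add P Q).
Proof. by move=> f g; apply: hom2P => n m x /=; rewrite addrC. Qed.
Fact hom2_add0 P Q : left_id (hom2_zero P Q) (@hom2_add P Q).
Proof. by move=> f; apply: hom2P => n m x /=; rewrite add0r. Qed.
Fact hom2_addN P Q : left_inverse (hom2_zero P Q) (@hom2_opp P Q) (@hom2_add P Q).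
Proof. by move=> f; apply: hom2P => n m x /=; rewrite addNr. Qed.
HB.instance Definition _ P Q := GRing.isZmodule.Build (hom2 P Q)
  (@hom2_addA P Q) (@hom2_addC P Q) (@hom2_add0 P Q) (@hom2_addN P Q).

Fact hom2_scaleA P Q a b (f : hom2 P Q) :
  hom2_scale a (hom2_scale b f) = hom2_scale (a * b) f.
Proof. by apply: hom2P => n m x /=; rewrite scalerA. Qed.
Fact hom2_scale1 P Q : left_id 1 (@hom2_scale P Q).
Proof. by move=> f; apply: hom2P => n m x /=; rewrite scale1r. Qed.
Fact hom2_scaleDr P Q : right_distributive (@hom2_scale P Q) +%R.
Proof. by move=> a f g; apply: hom2P => n m x /=; rewrite scalerDr. Qed.
Fact hom2_scaleDl P Q (f : hom2 P Q) :
  {morph (@hom2_scale P Q)^~ f : a b / a + b}.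
Proof. by move=> a b; apply: hom2P => n m x /=; rewrite scalerDl. Qed.
HB.instance Definition _ P Q := GRing.Zmodule_isLmodule.Build K (hom2 P Q)
  (@hom2_scaleA P Q) (@hom2_scale1 P Q) (@hom2_scaleDr P Q) (@hom2_scaleDl P Q).

Fact comp2_linear P Q S (g : hom2 Q S) (f : hom2 P Q) n m :
  linear (fun x => g n m (f n m x)).
Proof. by move=> a x y; rewrite !linearP. Qed.
Definition comp2 P Q S (g : hom2 Q S) (f : hom2 P Q) : hom2 P S :=
  Hom2 (comp2_linear g f).

End Hom2.

Definition zero_space (K : fieldType) : lmodType K := 'rV[K]_0.

Section Box.
Variables (K : fieldType) (P Q : bicollection K) (n m : nat).

(* The direct sum over k of P n k (x) Q k m, presented by the pure tensors
   (k, p, q) modulo bilinearity of (p, q) for each fixed k. *)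
Definition box_index : choiceType := {k : nat & (P n k * Q k m)%type}.

Definition pure_tensor k (p : P n k) (q : Q k m) : box_index :=
  Tagged (fun k => (P n k * Q k m)%type) (p, q).

Inductive box_rel : {freeg box_index / K} -> Prop :=
| BoxRelL k a (p p' : P n k) (q : Q k m) :
    box_rel (<< pure_tensor (a *: p + p') q >>
             - (a *: << pure_tensor p q >> + << pure_tensor p' q >>))
| BoxRelR k a (p : P n k) (q q' : Q k m) :
    box_rel (<< pure_tensor p (a *: q + q') >>
             - (a *: << pure_tensor p q >> + << pure_tensor p q' >>)).

Definition box_space : lmodType K := presented box_rel.

Definition tens k (p : P n k) (q : Q k m) : box_space :=
  gen box_rel (pure_tensor p q).

Lemma tens_linearl k (q : Q k m) : linear (fun p : P n k => tens p q).
Proof.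
move=> a p p'; rewrite /tens /gen -pi_presented_linear; apply/presented_eq.
by apply/relspanP => S _; apply; constructor.
Qed.

Lemma tens_linearr k (p : P n k) : linear (fun q : Q k m => tens p q).
Proof.
move=> a q q'; rewrite /tens /gen -pi_presented_linear; apply/presented_eq.
by apply/relspanP => S _; apply; constructor.
Qed.

Section Lift.
Variables (V : lmodType K) (phi : forall k, P n k -> Q k m -> V).
Hypothesis phil : forall k q, linear (fun p => @phi k p q).
Hypothesis phir : forall k p, linear (fun q => @phi k p q).

Definition box_phi (t : box_index) : V := phi (tagged t).1 (tagged t).2.

Fact box_phi_rel r : box_rel r -> fglift box_phi r = 0.
Proof.
have fgB : {morph fglift box_phi : x y / x - y} by exact: raddfB.
case=> [k a p p' q|k a p q q']; rewrite fgB fglift_linear !liftU !scale1r.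
  by rewrite /box_phi /= phil subrr.
by rewrite /box_phi /= phir subrr.
Qed.

Definition box_lift : box_space -> V := lift_presented (rel := box_rel) box_phi.

Lemma box_lift_linear : linear box_lift.
Proof. exact: lift_presented_linear box_phi_rel. Qed.

Lemma box_liftE k (p : P n k) (q : Q k m) : box_lift (tens p q) = phi p q.
Proof. by rewrite /box_lift /tens (lift_presented_gen box_phi_rel). Qed.
End Lift.
End Box.

Section BoxFunctor.
Variable K : fieldType.
Implicit Types P Q : bicollection K.

Definition box P Q : bicollection K := fun n m => box_space P Q n m.

Section Map.
Variables (P P' Q Q' : bicollection K) (f : hom2 P P') (g : hom2 Q Q').

Definition box_map_fun n m : box P Q n m -> box P' Q' n m :=
  box_lift (fun k (p : P n k) (q : Q k m) => tens (f n k p) (g k m q)).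

Fact box_map_linear n m : linear (@box_map_fun n m).
Proof.
apply: box_lift_linear => k x a y z.
  by rewrite linearP (tens_linearl (g k m x)).
by rewrite linearP (tens_linearr (f n k x)).
Qed.

Definition box_map : hom2 (box P Q) (box P' Q') := Hom2 box_map_linear.
End Map.

Definition vunit : bicollection K :=
  fun n m => if n == m then K^o : lmodType K else zero_space K.

(* 1_n when n = m, and 0 in the zero space vunit n m otherwise *)
Definition vone n m : vunit n m :=
  if n == m as b return (if b then K^o : lmodType K else zero_space K)
  then 1 else 0.

Definition vcoef n m : vunit n m -> K^o :=
  if n == m as b return ((if b then K^o : lmodType K else zero_space K) -> K^o)
  then id else fun=> 0.

Lemma vcoef_linear n m : linear (@vcoef n m).
Proof.
rewrite /vcoef /vunit; case: (n == m) => // a x y.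
by rewrite scaler0 addr0.
Qed.

End BoxFunctor.

(* A collection (P(k))_(k >= 1) is indexed from 0: its k-th term here stands
   for P(k+1). *)
Definition collection (K : fieldType) := nat -> lmodType K.

Section Letters.
Variable X : nat -> Type.

Definition letter := {k : nat & X k}.
Definition arity (l : letter) : nat := (tag l).+1.
Definition arities (w : seq letter) : nat := sumn (map arity w).
Definition is_word n m (w : seq letter) : bool :=
  (size w == n) && (arities w == m).

Lemma arities_cat w1 w2 : arities (w1 ++ w2) = (arities w1 + arities w2)%N.
Proof. by rewrite /arities map_cat sumn_cat. Qed.
End Letters.

Section Words.
Variables (K : fieldType) (P : collection K) (n m : nat).

Local Notation ltr := (letter (fun k => P k : Type)).
Local Notation lt k x := (Tagged (fun k => P k : Type) (x : P k)).

Definition word_index : choiceType := {w : seq {k : nat & P k} | is_word n m w}.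

(* T(P)(n,m), the direct sum over k_1 + ... + k_n = m of
   P(k_1) (x) ... (x) P(k_n), presented by the words p_1 ... p_n of total
   arity m modulo linearity in each letter. *)
Inductive word_rel : {freeg word_index / K} -> Prop :=
| WordRel w1 k a (x y : P k) w2 (u u1 u2 : word_index) :
    val u = w1 ++ lt k (a *: x + y) :: w2 ->
    val u1 = w1 ++ lt k x :: w2 ->
    val u2 = w1 ++ lt k y :: w2 ->
    word_rel (<< u >> - (a *: << u1 >> + << u2 >>)).

Definition word_space : lmodType K := presented word_rel.

(* The class of the word w; it is 0 when w is not of length n and arity m. *)
Definition word (w : seq ltr) : word_space :=
  if insub w is Some u then gen word_rel u else 0.

Lemma is_word_letter w1 k (x y : P k) w2 :
  is_word n m (w1 ++ lt k x :: w2) = is_word n m (w1 ++ lt k y :: w2).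
Proof. by rewrite /is_word /arities !size_cat !map_cat !sumn_cat. Qed.

Lemma word_linear w1 k w2 : linear (fun x : P k => word (w1 ++ lt k x :: w2)).
Proof.
move=> a x y; rewrite /word.
case: insubP => [u _ eu|].
  have wy := valP u; rewrite /= eu in wy; have wx := wy.
  rewrite (is_word_letter _ _ y) in wy; rewrite (is_word_letter _ _ x) in wx.
  case: insubP => [u1 _ e1|]; last by rewrite wx.
  case: insubP => [u2 _ e2|]; last by rewrite wy.
  rewrite /gen -pi_presented_linear; apply/presented_eq/relspanP => S _; apply.
  exact: WordRel eu e1 e2.
move=> h; have hy := h; rewrite (is_word_letter _ _ x) in h.
rewrite (is_word_letter _ _ y) in hy.
by rewrite !insubN // scaler0 addr0.
Qed.

Section Lift.
Variables (V : lmodType K) (phi : seq ltr -> V).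

Definition letter_linear : Prop := forall w1 k w2,
  (forall x : P k, is_word n m (w1 ++ lt k x :: w2)) ->
  linear (fun x : P k => phi (w1 ++ lt k x :: w2)).

Hypothesis phi_lin : letter_linear.

Fact word_phi_rel r :
  word_rel r -> fglift (fun u : word_index => phi (val u)) r = 0.
Proof.
have fgB : {morph fglift (fun u : word_index => phi (val u)) : x y / x - y}.
  exact: raddfB.
case=> w1 k a x y w2 u u1 u2 eu e1 e2.
rewrite fgB fglift_linear !liftU !scale1r eu e1 e2 phi_lin ?subrr // => z.
by rewrite (is_word_letter _ _ x) -e1; exact: (valP u1).
Qed.

Definition word_lift : word_space -> V :=
  lift_presented (rel := word_rel) (fun u : word_index => phi (val u)).

Lemma word_lift_linear : linear word_lift.
Proof. exact: lift_presented_linear word_phi_rel. Qed.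

Lemma word_liftE w : is_word n m w -> word_lift (word w) = phi w.
Proof.
move=> hw; rewrite /word; case: insubP => [u _ eu|]; last by rewrite hw.
by rewrite /word_lift (lift_presented_gen word_phi_rel) eu.
Qed.
End Lift.

Lemma word_lift_fun (V : lmodType K) a (phi phi1 phi2 : seq ltr -> V) z :
  (forall w, is_word n m w -> phi w = a *: phi1 w + phi2 w) ->
  word_lift phi z = a *: word_lift phi1 z + word_lift phi2 z.
Proof.
move=> e; rewrite /word_lift /lift_presented !fgliftE scaler_sumr -big_split /=.
by apply: eq_bigr => u _; rewrite (e _ (valP u)) scalerDr !scalerA mulrC.
Qed.

End Words.

Section TensorWords.
Variable K : fieldType.
Implicit Type P : collection K.

Definition T P : bicollection K := fun n m => word_space P n m.

(* T^+(P)(n,m) is T(P)(n,m) for n != m, and 0 otherwise. *)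
Definition Tplus P : bicollection K :=
  fun n m => if n == m then zero_space K else word_space P n m.

Definition Tincl_fun P n m : Tplus P n m -> T P n m :=
  if n == m as b
  return ((if b then zero_space K else word_space P n m) -> word_space P n m)
  then fun=> 0 else id.

Definition Tproj_fun P n m : T P n m -> Tplus P n m :=
  if n == m as b
  return (word_space P n m -> (if b then zero_space K else word_space P n m))
  then fun=> 0 else id.

Fact Tincl_linear P n m : linear (@Tincl_fun P n m).
Proof.
rewrite /Tincl_fun /Tplus; case: (n == m) => // a x y.
by rewrite scaler0 addr0.
Qed.

Fact Tproj_linear P n m : linear (@Tproj_fun P n m).
Proof.
rewrite /Tproj_fun /Tplus; case: (n == m) => // a x y.
by rewrite scaler0 addr0.
Qed.

Definition Tincl P : hom2 (Tplus P) (T P) := Hom2 (@Tincl_linear P).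
Definition Tproj P : hom2 (T P) (Tplus P) := Hom2 (@Tproj_linear P).

Definition ext_zero P (Q : bicollection K) (f : hom2 (Tplus P) Q) :
    hom2 (T P) Q :=
  comp2 f (Tproj P).

End TensorWords.

Section SpanCollection.
Variables (K : fieldType) (X : nat -> finType).

Definition span_coll : collection K := fun k => {ffun X k -> K^o}.

Local Notation sltr := (letter (fun k => span_coll k : Type)).
Local Notation xltr := (letter (fun k => X k : Type)).

Definition basis_letter (l : xltr) : sltr :=
  Tagged (fun k => span_coll k : Type)
    [ffun y => (y == tagged l)%:R : K^o].

Definition basis_word n m (w : seq xltr) : T span_coll n m :=
  word n m (map basis_letter w).

Section Ext.
Variables (V : lmodType K) (phi : seq xltr -> V).

(* multilinear extension to words of vectors of a function given on words of
   basis elements *)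
Fixpoint basis_ext (f : seq xltr -> V) (w : seq sltr) : V :=
  if w is l :: w' then
    \sum_(x : X (tag l)) (tagged l : span_coll (tag l)) x *:
      basis_ext (fun v => f (Tagged (fun k => X k : Type) x :: v)) w'
  else f [::].

Lemma basis_ext_linear n m : letter_linear n m (basis_ext phi).
Proof.
move=> w1 k w2 _; elim: w1 phi => [|l w1 IH] f a x y /=.
  rewrite scaler_sumr -big_split /=; apply: eq_bigr => z _.
  by rewrite !ffunE scalerDl scalerA.
rewrite scaler_sumr -big_split /=; apply: eq_bigr => z _.
by rewrite IH scalerDr !scalerA mulrC.
Qed.

Definition basis_lift n m : T span_coll n m -> V :=
  word_lift (n := n) (m := m) (basis_ext phi).

Lemma basis_lift_linear n m : linear (@basis_lift n m).
Proof. exact/word_lift_linear/basis_ext_linear. Qed.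

Lemma basis_extE f w : basis_ext f (map basis_letter w) = f w.
Proof.
elim: w f => //= l w IH f; rewrite (bigD1 (tagged l)) //= big1 => [|x nx].
  by rewrite IH ffunE eqxx scale1r addr0; case: l.
by rewrite ffunE (negPf nx) scale0r.
Qed.

Lemma basis_liftE n m w :
  is_word n m w -> basis_lift (basis_word n m w) = phi w.
Proof.
move=> hw; rewrite /basis_lift /basis_word word_liftE ?basis_extE //.
  exact: basis_ext_linear.
by move: hw; rewrite /is_word /arities size_map -map_comp.
Qed.
End Ext.
End SpanCollection.

Section Multilinear.
Variables (K : fieldType) (B : lmodType K) (k : nat).

Definition multilinear (f : k.-tuple B -> B) : Prop :=
  forall (i : 'I_k) (t : k.-tuple B),
    linear (fun x => f [tuple (if j == i then x else tnth t j) | j < k]).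

Definition multilinear_pred : {pred (k.-tuple B -> B)} :=
  fun f => `[< multilinear f >].

Fact multilinear_submod : submod_closed multilinear_pred.
Proof.
split=> [|a f g /asboolP hf /asboolP hg]; apply/asboolP => i t b x y.
  by rewrite scaler0 addr0.
rewrite !fctE hf hg !scalerDr !scalerA (mulrC b) -!addrA; congr (_ + _).
by rewrite addrCA.
Qed.
HB.instance Definition _ := GRing.isSubmodClosed.Build K (k.-tuple B -> B)
  multilinear_pred multilinear_submod.

Record mlin := MLin {
  mlin_fun :> k.-tuple B -> B;
  mlin_funP : mlin_fun \in multilinear_pred
}.
HB.instance Definition _ := [isSub for mlin_fun].
HB.instance Definition _ := [Choice of mlin by <:].
HB.instance Definition _ := [SubChoice_isSubLmodule of mlin by <:].

(* value on a list of arguments; 0 when their number is not k *)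
Definition mlin_eval (f : mlin) (s : seq B) : B :=
  if insub s is Some t then f t else 0.

Lemma mlin_eval_linear (s : seq B) : linear (mlin_eval ^~ s).
Proof.
move=> a f g; rewrite /mlin_eval; case: insubP => // _.
by rewrite scaler0 addr0.
Qed.

Lemma mlin_eval_linear_arg (f : mlin) s1 s2 :
  linear (fun x => mlin_eval f (s1 ++ x :: s2)).
Proof.
have sz x y : size (s1 ++ x :: s2) = size (s1 ++ y :: s2) by rewrite !size_cat.
move=> a x y; have [hs|hs] := boolP (size (s1 ++ x :: s2) == k); last first.
  rewrite /mlin_eval !insubN ?(sz _ x) // ?scaler0 ?addr0 //.
have lt1 : (size s1 < k)%N.
  by rewrite -(eqP hs) size_cat /= addnS ltnS leq_addr.
pose t : k.-tuple B := Tuple hs.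
have E z : mlin_eval f (s1 ++ z :: s2) =
    f [tuple (if j == Ordinal lt1 then z else tnth t j) | j < k].
  rewrite /mlin_eval; case: insubP => [u _ eu|]; last by rewrite (sz z x) hs.
  congr (mlin_fun f _); apply: eq_from_tnth => j; rewrite tnth_mktuple.
  rewrite !(tnth_nth 0) eu /= !nth_cat -val_eqE /=.
  case: ltngtP => [|ltj|->]; rewrite ?subnn //.
  by case: (j - size s1)%N (subn_gt0 (size s1) j) => [|i]; rewrite ?ltj.
by rewrite !E; have /asboolP := mlin_funP f; apply.
Qed.
End Multilinear.

Section HomOperad.
Variables (K : fieldType) (B : lmodType K).

Definition homB : collection K := fun k => mlin B k.+1.
Definition hletter : Type := letter (fun k => homB k : Type).

Definition leval (l : hletter) (s : seq B) : B := mlin_eval (tagged l) s.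

(* the value at b_1 ... b_N of the composite of p with the letters qs, the
   arguments being cut into consecutive groups of lengths |q_1|, |q_2|, ... *)
Definition comp_eval (p : hletter) (qs : seq hletter) (s : seq B) : B :=
  leval p [seq leval qb.1 qb.2 | qb <- zip qs (reshape (map (@arity _) qs) s)].

Lemma comp_eval_slot (qs : seq hletter) s1 s2 x0 :
  size (s1 ++ x0 :: s2) = arities qs ->
  exists u1 u2, exists2 g : B -> B, linear g & forall x,
    [seq leval qb.1 qb.2 |
       qb <- zip qs (reshape (map (@arity _) qs) (s1 ++ x :: s2))]
    = u1 ++ g x :: u2.
Proof.
elim: qs s1 => [|q qs IH] s1; first by rewrite size_cat addnS.
rewrite /arities /= => sz; have [lt1|le1] := ltnP (size s1) (arity q).
  exists [::], [seq leval qb.1 qb.2 |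
    qb <- zip qs (reshape (map (@arity _) qs)
                    (drop (arity q - size s1).-1 s2))].
  exists (fun x => leval q (s1 ++ x :: take (arity q - size s1).-1 s2)).
    exact: mlin_eval_linear_arg.
  move=> x /=; rewrite take_cat drop_cat ltnNge (ltnW lt1) /=.
  by case: (arity q - size s1)%N (subn_gt0 (size s1) (arity q)) => [|i] //=;
    rewrite lt1.
have sz' : size (drop (arity q) s1 ++ x0 :: s2) = arities qs.
  apply/eqP; rewrite -(eqn_add2l (arity q)) -sz !size_cat size_drop addnA.
  by rewrite subnKC.
have [u1 [u2 [g gl E]]] := IH _ sz'.
exists (leval q (take (arity q) s1) :: u1), u2, g => // x /=.
rewrite take_cat drop_cat; case: ltngtP le1 => // [_|e] _; first by rewrite E.
have e0 : (arity q - size s1)%N = 0%N by apply/eqP; rewrite subn_eq0 -e.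
have le2 : (size s1 <= arity q)%N by rewrite -e.
by rewrite e0 take0 cats0 drop0 -E drop_oversize // take_oversize.
Qed.

Lemma comp_eval_linear_arg p qs s1 s2 (x0 : B) :
  size (s1 ++ x0 :: s2) = arities qs ->
  linear (fun x => comp_eval p qs (s1 ++ x :: s2)).
Proof.
move=> /comp_eval_slot[u1 [u2 [g gl E]]] a x y.
by rewrite /comp_eval !E gl; exact: mlin_eval_linear_arg.
Qed.

Fact hcomp_multilinear (p : hletter) (qs : seq hletter) :
  (fun t : (arities qs).-1.+1.-tuple B => comp_eval p qs t)
    \in @multilinear_pred K B (arities qs).-1.+1.
Proof.
apply/asboolP => i t.
have E x : [tuple (if j == i then x else tnth t j) | j < (arities qs).-1.+1]
    = take i t ++ x :: drop i.+1 t :> seq B.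
  have sz : size (take i t ++ x :: drop i.+1 t) = (arities qs).-1.+1.
    rewrite size_cat /= size_drop size_takel ?size_tuple ?(ltnW (ltn_ord i)) //.
    by rewrite -addSnnS subnKC.
  apply: (@eq_from_nth _ 0); rewrite size_tuple ?sz // => j ltj.
  rewrite -[j]/(val (Ordinal ltj)) -tnth_nth tnth_mktuple /=.
  rewrite nth_cat size_takel ?size_tuple ?(ltnW (ltn_ord i)) // -val_eqE /=.
  case: ltngtP => [lt|lt|->]; last by rewrite subnn.
    by rewrite nth_take // (tnth_nth 0).
  rewrite (tnth_nth 0) /= -(subnSK lt) /= nth_drop addSn -addnS subnSK //.
  by rewrite subnKC // ltnW.
move=> a x y; rewrite !E.
case: qs i t E => [|q qs] i t E.
  rewrite /comp_eval /= /leval /mlin_eval !insubN ?scaler0 ?addr0 //.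
apply: (comp_eval_linear_arg p (x0 := x)); rewrite -E size_tuple.
by [].
Qed.

(* the composite of p with the letters of qs; the index is arity minus 1 *)
Definition hcomp (p : hletter) (qs : seq hletter) : hletter :=
  Tagged (fun k => homB k : Type) (MLin (hcomp_multilinear p qs)).

Fact hid_multilinear :
  (fun t : 1.-tuple B => thead t) \in @multilinear_pred K B 1.
Proof.
by apply/asboolP => i t a x y; rewrite /thead !tnth_mktuple (ord1 i) eqxx.
Qed.
Definition hid : hletter :=
  Tagged (fun k => homB k : Type) (MLin hid_multilinear : homB 0).

Fixpoint vcomp (ps qs : seq hletter) : seq hletter :=
  if ps is p :: ps' then
    hcomp p (take (arity p) qs) :: vcomp ps' (drop (arity p) qs)
  else [::].

Definition mletter (j : nat) (f : seq B -> B) : hletter :=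
  Tagged (fun k => homB k : Type)
    (insubd (0 : mlin B j.-1.+1) (fun t : j.-1.+1.-tuple B => f t) : homB j.-1).

Lemma hcompE p qs : hcomp p qs = mletter (arities qs) (comp_eval p qs).
Proof.
congr (Tagged _ _); apply: val_inj.
by rewrite /= insubdK //; exact: hcomp_multilinear.
Qed.

Lemma word_mletter n m w1 w2 j (a : K) (f g h : seq B -> B) :
  (fun t : j.-1.+1.-tuple B => f t) \in @multilinear_pred K B j.-1.+1 ->
  (fun t : j.-1.+1.-tuple B => g t) \in @multilinear_pred K B j.-1.+1 ->
  (forall s, h s = a *: f s + g s) ->
  word n m (w1 ++ mletter j h :: w2) =
  a *: word n m (w1 ++ mletter j f :: w2) + word n m (w1 ++ mletter j g :: w2).
Proof.
move=> hf hg hfg; rewrite -word_linear; congr (word n m (w1 ++ _ :: w2)).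
have hE : (fun t : j.-1.+1.-tuple B => h t) =
    a *: (fun t : j.-1.+1.-tuple B => f t) + (fun t => g t).
  by apply/funext => t; rewrite hfg.
congr (Tagged _ _); apply: val_inj.
have hh : (fun t : j.-1.+1.-tuple B => h t) \in @multilinear_pred K B _.
  by rewrite hE; apply: rpredD => //; exact: rpredZ.
rewrite (insubdK 0 hh) hE; congr (a *: _ + _); symmetry; exact: insubdK.
Qed.

Lemma hcomp_linearl n m w1 w2 k (qs : seq hletter) :
  linear (fun p : homB k =>
    word n m (w1 ++ hcomp (Tagged (fun k => homB k : Type) p) qs :: w2)).
Proof.
move=> a x y; rewrite !hcompE; apply: word_mletter => [||s].
- exact: hcomp_multilinear.
- exact: hcomp_multilinear.
- exact: mlin_eval_linear.
Qed.

Lemma comp_eval_letter k (q1 q2 : seq hletter) s :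
  exists u1 u2 s', forall p (x : homB k),
    comp_eval p (q1 ++ Tagged (fun k => homB k : Type) x :: q2) s
    = leval p (u1 ++ mlin_eval x s' :: u2).
Proof.
have [u1 [u2 [s' E]]] : exists u1 u2 s', forall x : homB k,
    [seq leval qb.1 qb.2 |
       qb <- zip (q1 ++ Tagged (fun k => homB k : Type) x :: q2)
        (reshape (map (@arity _) (q1 ++ Tagged (fun k => homB k : Type) x :: q2))
           s)] = u1 ++ mlin_eval x s' :: u2.
  elim: q1 s => [|q q1 IH] s /=; first exists [::],
    [seq leval qb.1 qb.2 | qb <- zip q2 (reshape (map (@arity _) q2)
                                          (drop k.+1 s))], (take k.+1 s).
    by [].
  have [u1 [u2 [s' E]]] := IH (drop (arity q) s).
  by exists (leval q (take (arity q) s) :: u1), u2, s' => x; rewrite E.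
by exists u1, u2, s' => p x; rewrite /comp_eval E.
Qed.

Lemma hcomp_linearr n m w1 w2 k p (q1 q2 : seq hletter) :
  linear (fun x : homB k =>
    word n m (w1 ++ hcomp p (q1 ++ Tagged (fun k => homB k : Type) x :: q2)
                 :: w2)).
Proof.
move=> a x y; rewrite !hcompE.
pose j := (arities q1 + k.+1 + arities q2)%N.
have hj (z : homB k) :
    arities (q1 ++ Tagged (fun k => homB k : Type) z :: q2) = j.
  by rewrite arities_cat /j -addnA.
have hz (z : homB k) := hcomp_multilinear p
  (q1 ++ Tagged (fun k => homB k : Type) z :: q2).
rewrite !hj; apply: word_mletter => [||s].
- by have := hz x; rewrite hj.
- by have := hz y; rewrite hj.
have [u1 [u2 [s' E]]] := comp_eval_letter k q1 q2 s.
by rewrite !E mlin_eval_linear; exact: mlin_eval_linear_arg.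
Qed.

Lemma vcomp_cat ps1 ps2 qs : vcomp (ps1 ++ ps2) qs =
  vcomp ps1 (take (arities ps1) qs) ++ vcomp ps2 (drop (arities ps1) qs).
Proof.
elim: ps1 qs => [|p ps1 IH] qs /=; first by rewrite drop0.
rewrite IH /arities /= -/(arities _) take_takel ?leq_addr //.
by rewrite drop_drop addnC take_drop addnC.
Qed.

Lemma vcomp_linearl n m w0 k (p1 p2 qs : seq hletter) :
  linear (fun x : homB k => word n m
    (w0 ++ vcomp (p1 ++ Tagged (fun k => homB k : Type) x :: p2) qs)).
Proof.
move=> a x y; rewrite !vcomp_cat /= !catA.
exact: hcomp_linearl.
Qed.

Lemma vcomp_linearr n m w0 k (ps q1 q2 : seq hletter) :
  (size q1 < arities ps)%N ->
  linear (fun x : homB k => word n m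
    (w0 ++ vcomp ps (q1 ++ Tagged (fun k => homB k : Type) x :: q2))).
Proof.
elim: ps w0 q1 => [|p ps IH] w0 q1 //; rewrite /arities /= => sz a x y.
have [lt1|le1] := ltnP (size q1) (arity p).
  rewrite !take_cat !drop_cat ltnNge (ltnW lt1) /=.
  have [i ->] : exists i, (arity p - size q1)%N = i.+1.
    by exists (arity p - size q1).-1; rewrite prednK // subn_gt0.
  exact: hcomp_linearr.
have sz' : (size (drop (arity p) q1) < arities ps)%N.
  by rewrite size_drop ltn_subLR.
have dE (z : homB k) :
    drop (arity p) (q1 ++ Tagged (fun k => homB k : Type) z :: q2)
    = drop (arity p) q1 ++ Tagged (fun k => homB k : Type) z :: q2.
  rewrite drop_cat; case: ltngtP le1 => // e _.
  have le2 : (size q1 <= arity p)%N by rewrite e.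
  have -> : (arity p - size q1)%N = 0%N by apply/eqP; rewrite subn_eq0 e.
  by rewrite drop0 (drop_oversize le2).
have tE (z : homB k) :
    take (arity p) (q1 ++ Tagged (fun k => homB k : Type) z :: q2)
    = take (arity p) q1 by rewrite takel_cat.
rewrite !dE !tE.
have := IH (rcons w0 (hcomp p (take (arity p) q1))) _ sz' a x y.
by rewrite !cat_rcons.
Qed.

End HomOperad.

Section HomBicollection.
Variables (K : fieldType) (B : lmodType K).
Local Notation TB := (T (homB B)).

(* (p_1 ... p_n) (x) (q_1 ... q_N) |-> the word whose i-th letter is p_i
   composed with its consecutive group of |p_i| letters q_j, extended
   bilinearly *)
Definition nabla_tens n m k (x : TB n k) (y : TB k m) : TB n m :=
  word_lift (fun ps : seq (hletter B) =>
    word_lift (fun qs : seq (hletter B) =>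
      word n m (vcomp ps qs) : TB n m) y) x.

Fact nabla_linearl n m k (y : TB k m) :
  linear (fun x : TB n k => nabla_tens x y).
Proof.
apply: word_lift_linear => w1 j w2 _ a p p'.
by apply: word_lift_fun => qs _; exact: (vcomp_linearl n m [::]).
Qed.

Fact nabla_linearr n m k (x : TB n k) :
  linear (fun y : TB k m => nabla_tens x y).
Proof.
move=> a y y'; apply: word_lift_fun => ps /andP[_ /eqP ak].
apply: word_lift_linear => w1 j w2 h; apply: (vcomp_linearr n m [::]).
by have /andP[/eqP + _] := h 0; rewrite ak size_cat /= => <-; rewrite addnS ltnS leq_addr.
Qed.

Definition nabla_fun n m : box TB TB n m -> TB n m :=
  box_lift (@nabla_tens n m).

Fact nabla_fun_linear n m : linear (@nabla_fun n m).
Proof.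
by apply: box_lift_linear => k; [exact: nabla_linearl | exact: nabla_linearr].
Qed.

Definition nabla : hom2 (box TB TB) TB := Hom2 nabla_fun_linear.

(* 1_n |-> id_B^n *)
Definition eta_fun n m (c : vunit K n m) : TB n m :=
  vcoef c *: word n m (nseq n (hid B)).

Fact eta_linear n m : linear (@eta_fun n m).
Proof. by move=> a x y; rewrite /eta_fun vcoef_linear scalerDl scalerA. Qed.

Definition eta : hom2 (vunit K) TB := Hom2 eta_linear.

End HomBicollection.

Definition noncrossing n (P : {set {set 'I_n}}) : bool :=
  [forall V in P, forall W in P, (V != W) ==>
     [forall a in V, forall c in V, forall b in W, forall d in W,
        ~~ [&& a < b, b < c & c < d]%N]].

Definition is_nc n (P : {set {set 'I_n}}) : bool :=
  partition P [set: 'I_n] && noncrossing P.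

Definition NC n : finType := {P : {set {set 'I_n}} | is_nc P}.

(* The inputs of an element of NC n are its n + 1 gaps, in accordance with the
   arity of letters. *)
Definition ncletter := {n : nat & NC n}.
Definition blocks (p : ncletter) : {set {set 'I_(tag p)}} := val (tagged p).

Section Renumber.
Variables (n : nat) (Q : {set {set 'I_n}}).

Local Notation D := (cover Q).
Local Notation ev := (fun i : 'I_#|D| => @enum_val _ (mem D) i).

Lemma enum_val_ltn (A : {set 'I_n}) (i j : 'I_#|A|) :
  (@enum_val _ (mem A) i < @enum_val _ (mem A) j)%N = (i < j)%N.
Proof.
have srt : sorted ltn [seq val x | x <- enum A].
  rewrite sorted_map /enum_mem; apply: sorted_filter.
    by move=> a b c; exact: ltn_trans.
  by rewrite -[sorted _ _]sorted_map -enumT val_enum_ord iota_ltn_sorted.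
have key (a b : 'I_#|A|) : (a < b)%N ->
    (@enum_val _ (mem A) a < @enum_val _ (mem A) b)%N.
  move=> ab; rewrite (enum_val_nth (enum_val i)) (enum_val_nth (enum_val i) b).
  have sz (c : 'I_#|A|) : (c < size (enum A))%N by rewrite -cardE.
  have := sorted_ltn_nth ltn_trans 0%N srt.
  move=> /(_ a b); rewrite !inE !size_map !sz => /(_ isT isT ab).
  by rewrite !(nth_map (enum_val i)).
case: (ltngtP i j) => [/key //|/key lt|/ord_inj ->].
  by apply/negbTE; rewrite -leqNgt ltnW.
by rewrite ltnn.
Qed.

(* the blocks of Q, with the elements of their union D renumbered in
   increasing order *)
Definition renumber : {set {set 'I_#|D|}} :=
  [set ev @^-1: V | V : {set 'I_n} in Q].

Variable P : {set {set 'I_n}}.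
Hypotheses (ncP : is_nc P) (sQP : Q \subset P).

Fact renumber_nc : is_nc renumber.
Proof.
have /andP[/and3P[_ tP P0] /forall_inP xP] := ncP.
have ev_surj V x : V \in Q -> x \in V -> exists i, ev i = x.
  move=> VQ xV; have xD : x \in D by apply/bigcupP; exists V.
  by exists (enum_rank_in xD x); rewrite enum_rankK_in.
have blk_eq V W : V \in Q -> W \in Q -> V != W -> [disjoint V & W].
  by move=> VQ WQ; apply: (trivIsetP tP); exact: (subsetP sQP).
apply/andP; split.
  apply/and3P; split.
  - apply/eqP/setP => i; rewrite inE; apply/bigcupP.
    have /bigcupP[V VQ iV] := enum_valP i.
    by exists (ev @^-1: V); [exact: imset_f | rewrite inE].
  - apply/trivIsetP => _ _ /imsetP[V VQ ->] /imsetP[W WQ ->] ne.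
    have nVW : V != W by apply: contraNneq ne => ->.
    have dVW := blk_eq _ _ VQ WQ nVW.
    rewrite -setI_eq0 -preimsetI; move: dVW; rewrite -setI_eq0 => /eqP ->.
    by rewrite preimset0.
  - apply/negP => /imsetP[V VQ e0].
    have /set0Pn[x xV] : V != set0.
      by apply: contraNneq P0 => <-; exact: (subsetP sQP).
    have [i ei] := ev_surj _ _ VQ xV.
    have : i \in ev @^-1: V by rewrite inE ei.
    by rewrite -e0 inE.
apply/forall_inP => _ /imsetP[V VQ ->]; apply/forall_inP => _ /imsetP[W WQ ->].
apply/implyP => ne.
have nVW : V != W by apply: contraNneq ne => ->.
have /forall_inP/(_ W (subsetP sQP _ WQ))/implyP/(_ nVW) :=
  xP V (subsetP sQP _ VQ).
move=> h; apply/forall_inP => a; rewrite inE => aV.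
apply/forall_inP => c; rewrite inE => cV.
apply/forall_inP => b; rewrite inE => bW.
apply/forall_inP => d; rewrite inE => dW.
have := h; move=> /forall_inP/(_ _ aV)/forall_inP/(_ _ cV).
move=> /forall_inP/(_ _ bW)/forall_inP/(_ _ dW).
by rewrite !enum_val_ltn.
Qed.

End Renumber.

Fact nc_empty_subproof : is_nc (set0 : {set {set 'I_0}}).
Proof.
apply/andP; split; last by apply/forall_inP => V; rewrite inE.
apply/and3P; split; last by rewrite inE.
  by apply/eqP/setP => -[].
by apply/trivIsetP => A B; rewrite inE.
Qed.

(* the empty partition, of arity 1 *)
Definition nc_empty : ncletter :=
  Tagged (fun n => NC n : Type) (exist _ set0 nc_empty_subproof : NC 0).

(* the sub-collection of the blocks of p that belong to S, renumbered *)
Definition subpart (p : ncletter) (S : {set {set 'I_(tag p)}}) : ncletter :=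
  Tagged (fun n => NC n : Type)
    (exist _ (renumber (blocks p :&: S))
       (renumber_nc (valP (tagged p)) (subsetIl _ _)) : NC _).

Section Cuts.
Variable p : ncletter.
Local Notation n := (tag p).
Implicit Types (V W : {set 'I_n}) (L : {set {set 'I_n}}).

(* V being a block, the last two conditions say min V <= w <= max V. *)
Definition nested W V : bool :=
  (W != V) &&
  [forall w in W, [exists a in V, a <= w] && [exists b in V, w <= b]]%N.

Definition lowerset L : bool :=
  (L \subset blocks p) &&
  [forall V in L, forall W in blocks p, nested V W ==> (W \in L)].

(* the j-th gap of A: the positions outside A that are preceded by exactly j
   elements of A *)
Definition gap (A : {set 'I_n}) (j : nat) : {set 'I_n} :=
  [set i | (i \notin A) && (#|[set a in A | a < i]%N| == j)].

Definition lower (L : {set {set 'I_n}}) : ncletter := subpart L.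

(* the word U_0 ... U_q, where U_j consists of the blocks lying in the j-th of
   the q + 1 gaps of L *)
Definition upper (L : {set {set 'I_n}}) : seq ncletter :=
  [seq subpart [set V : {set 'I_n} | V \subset gap (cover L) j]
     | j <- iota 0 #|cover L|.+1].

Definition one_in L : bool := [exists i in cover L, i == 0%N :> nat].

Definition cuts : seq (ncletter * seq ncletter) :=
  [seq (lower L, upper L) | L <- enum [set L | lowerset L]].

(* the cuts with 1 in L (b = true) or 1 in U (b = false) *)
Definition half_cuts (b : bool) : seq (ncletter * seq ncletter) :=
  [seq (lower L, upper L) | L <- enum [set L | lowerset L & one_in L == b]].

End Cuts.

(* Terms of Delta(p_1 ... p_n) = Delta(p_1) ... Delta(p_n), where
   (a (x) b)(a' (x) b') = aa' (x) bb'. *)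
Fixpoint word_cuts (w : seq ncletter) : seq (seq ncletter * seq ncletter) :=
  if w is p :: w' then
    [seq (c.1 :: d.1, c.2 ++ d.2) | c <- cuts p, d <- word_cuts w']
  else [:: ([::], [::])].

(* Terms of Delta^+ on a word empty^q p w' with p non-empty, that is of
   (empty^q (x) empty^q) Delta^+(p) Delta(w'). *)
Fixpoint word_half_cuts (b : bool) (w : seq ncletter) :
    seq (seq ncletter * seq ncletter) :=
  if w is p :: w' then
    if p == nc_empty then
      [seq (nc_empty :: d.1, nc_empty :: d.2) | d <- word_half_cuts b w']
    else
      [seq (c.1 :: d.1, c.2 ++ d.2) | c <- half_cuts p b, d <- word_cuts w']
  else [::].

Section Coproduct.
Variable K : fieldType.

(* calNC k is spanned by NC(k); as a term of a collection it has arity k + 1. *)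
Definition calNC : collection K := span_coll K NC.
Local Notation TNC := (T calNC).

Definition nc_word n m (w : seq ncletter) : TNC n m := @basis_word K NC n m w.

(* L (x) U; for a cut, the length of U is the arity of L and the arity of U is
   that of the original word, so neither factor is the default value 0. *)
Definition cut_term n m (c : seq ncletter * seq ncletter) : box TNC TNC n m :=
  tens (nc_word n (arities c.1) c.1) (nc_word (arities c.1) m c.2).

Definition counit_word n m (w : seq ncletter) : vunit K n m :=
  if all (pred1 nc_empty) w then @vone K n m else 0.

Definition counit : hom2 TNC (vunit K) :=
  Hom2 (fun n m => @basis_lift_linear K NC _ (@counit_word n m) n m).

Definition coproduct_word n m (w : seq ncletter) : box TNC TNC n m :=
  \sum_(c <- word_cuts w) cut_term n m c.

Definition coproduct : hom2 TNC (box TNC TNC) :=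
  Hom2 (fun n m => @basis_lift_linear K NC _ (@coproduct_word n m) n m).

Definition half_coproduct_word (b : bool) n m (w : seq ncletter) :
    box TNC TNC n m :=
  \sum_(c <- word_half_cuts b w) cut_term n m c -
  (if b then tens (nc_word n m w) (nc_word m m (nseq m nc_empty))
   else tens (nc_word n n (nseq n nc_empty)) (nc_word n m w)).

(* Delta_prec for b = true, Delta_succ for b = false; a map on T^+ *)
Definition half_coproduct (b : bool) : hom2 (Tplus calNC) (box TNC TNC) :=
  comp2 (Hom2 (fun n m => @basis_lift_linear K NC _ (@half_coproduct_word b n m) n m))
        (Tincl calNC).

End Coproduct.

(* A unital algebra over K. Unlike algType, 1 = 0 is allowed. *)
Record unital_algebra (K : fieldType) := UnitalAlgebra {
  ualg_space :> lmodType K;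
  ualg_one : ualg_space;
  ualg_mul : ualg_space -> ualg_space -> ualg_space;
  ualg_mulA : associative ualg_mul;
  ualg_mul1l : left_id ualg_one ualg_mul;
  ualg_mul1r : right_id ualg_one ualg_mul;
  ualg_linearl : forall b, linear (ualg_mul^~ b);
  ualg_linearr : forall a, linear (ualg_mul a)
}.

Section Shuffle.
Variables (K : fieldType) (D : lmodType K) (prec succ : D -> D -> D).

Record shuffle_algebra : Prop := ShuffleAlgebra {
  prec_linearl : forall b, linear (prec^~ b);
  prec_linearr : forall a, linear (prec a);
  succ_linearl : forall b, linear (succ^~ b);
  succ_linearr : forall a, linear (succ a);
  shuffle_prec : forall a b c,
    prec (prec a b) c = prec a (prec b c + succ b c);
  shuffle_mid : forall a b c, prec (succ a b) c = succ a (prec b c);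
  shuffle_succ : forall a b c,
    succ a (succ b c) = succ (succ a b + prec a b) c
}.

(* Augmentation by a unit: the direct sum of K 1 and D, with 1 = (1, 0).  The
   half-products are partial, 1 prec 1 and 1 succ 1 being left undefined. *)
Definition augmented : lmodType K := (K^o * D)%type.
Definition aug_one : augmented := (1, 0).
Definition aug_in (a : D) : augmented := (0, a).

Record augmented_shuffle_algebra
    (aprec asucc : augmented -> augmented -> option augmented)
    (amul : augmented -> augmented -> augmented) : Prop :=
  AugmentedShuffleAlgebra {
  aug_shuffle : shuffle_algebra;
  amul_linearl : forall y, linear (amul^~ y);
  amul_linearr : forall x, linear (amul x);
  amulA : associative amul;
  amul1l : left_id aug_one amul;
  amul1r : right_id aug_one amul;
  amul_in : forall a b, amul (aug_in a) (aug_in b) = aug_in (prec a b + succ a b);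
  aprec_in : forall a b, aprec (aug_in a) (aug_in b) = Some (aug_in (prec a b));
  asucc_in : forall a b, asucc (aug_in a) (aug_in b) = Some (aug_in (succ a b));
  aprec1r : forall a, aprec (aug_in a) aug_one = Some (aug_in a);
  aprec1l : forall a, aprec aug_one (aug_in a) = Some 0;
  asucc1l : forall a, asucc aug_one (aug_in a) = Some (aug_in a);
  asucc1r : forall a, asucc (aug_in a) aug_one = Some 0;
  aprec11 : aprec aug_one aug_one = None;
  asucc11 : asucc aug_one aug_one = None
}.
End Shuffle.

Section Convolution.
Variables (K : fieldType) (B : unital_algebra K).
Local Notation TNC := (T (calNC K)).
Local Notation TB := (T (homB B)).

Definition homPlus : lmodType K := hom2 (Tplus (calNC K)) TB.

Definition conv (f g : hom2 TNC TB) : hom2 TNC TB :=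
  comp2 (nabla B) (comp2 (box_map f g) (coproduct K)).

Definition half_conv (b : bool) (f g : homPlus) : homPlus :=
  comp2 (nabla B)
    (comp2 (box_map (ext_zero f) (ext_zero g)) (half_coproduct K b)).

Definition hprec : homPlus -> homPlus -> homPlus := half_conv true.
Definition hsucc : homPlus -> homPlus -> homPlus := half_conv false.

Definition unit_conv : hom2 TNC TB := comp2 (eta B) (counit K).

(* The pair (c, f) of homBar stands for the morphism c (eta o counit) + f, f
   being extended by zero. *)
Definition homBar : lmodType K := augmented homPlus.

Definition homBar_mor (x : homBar) : hom2 TNC TB :=
  (x.1 : K) *: unit_conv + ext_zero x.2.

(* Bilinear extensions of f prec e = e succ f = f and e prec f = f succ e = 0;
   they are undefined (None) when the term e prec e, resp. e succ e, occurs. *)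
Definition bar_prec (x y : homBar) : option homBar :=
  if x.1 * y.1 == 0 then Some (0, y.1 *: x.2 + hprec x.2 y.2) else None.
Definition bar_succ (x y : homBar) : option homBar :=
  if x.1 * y.1 == 0 then Some (0, x.1 *: y.2 + hsucc x.2 y.2) else None.

End Convolution.

(* Main.v *)
Require Import Defs.
From HB Require Import structures.
From mathcomp Require Import all_boot all_order all_algebra.
From mathcomp Require Import boolp generic_quotient freeg reals complex.

Set Implicit Arguments.
Unset Strict Implicit.
Unset Printing Implicit Defensive.

(** Evaluated on a word of partitions, a convolution product is the finite sum
    over the cuts (L, U) of the word of the composites of f(L) with g(U), and
    the two half-products are the same sum restricted to the cuts with 1 in L,
    respectively 1 in U, where 1 is the first element of the first non-empty
    letter; the terms subtracted in the reduced coproducts do not contribute,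
    because f and g are extended by zero.  Since the vertical
    product of T(Hom(B)) is associative ([nabla_tensA]), the products of three
    factors are sums over pairs of nested cuts, and every associativity
    statement becomes an equality between two ways of enumerating these.

    A cut of a partition is a set A of positions, the union of the blocks of L;
    the admissible A are those for which each block lies either in A or in a
    single gap of A.  Cutting first by A and then cutting the lower part, or
    first cutting by A' and then cutting the upper part, both amount to choosing
    two sets A' <= A: the gaps of A refine those of A' ([gaps_refine]), the
    traces on A of the gaps of A' are the gaps of A' in A ([gaps_filter]), and
    the two admissibility conditions are equivalent ([ok_cut_triple]).  This is
    the coassociativity of the coproduct ([coassoc_letter], [word_coassoc]).
    Recording in which of the three layers the position 1 lies (A', A minus A'
    or the complement of A) splits it into the three relations
    [half_coassoc_fst], [half_coassoc_mid] and [half_coassoc_lst], which are the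
    three shuffle identities.

    The unit is handled by the only cut with empty upper part and the only cut
    with empty lower part.  The map sending (c, f) to c e + f is injective: on
    the empty word, f vanishes while e takes a nonzero value.  The associativity
    and bilinearity of the product on the augmented space then follow from those
    of the convolution product. *)

(** * Lists cut along a predicate *)

Section Gaps.
Variable T : eqType.
Implicit Types (A : pred T) (s t : seq T) (r : rel T).

(** The runs of s between its elements in A: if s = u_0 a_1 u_1 ... a_p u_p, where
    the a_i are the elements in A, this is the list of the p + 1 (possibly empty)
    lists u_i. *)
Fixpoint gaps A s : seq (seq T) :=
  if s is x :: s' then
    if A x then [::] :: gaps A s'
    else (x :: head [::] (gaps A s')) :: behead (gaps A s')
  else [:: [::]].

Lemma gaps_head A s : gaps A s = head [::] (gaps A s) :: behead (gaps A s).
Proof. by case: s => //= x s; case: (A x). Qed.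

Lemma size_gaps A s : size (gaps A s) = (count A s).+1.
Proof.
elim: s => //= x s IH; case: (A x) => /=; first by rewrite IH.
by rewrite size_behead IH.
Qed.

Lemma flatten_gaps A s : flatten (gaps A s) = filter (predC A) s.
Proof.
elim: s => //= x s IH; case: (A x) => //=.
by rewrite -IH [in RHS]gaps_head.
Qed.

Lemma sum_size_gaps A s : sumn [seq (size t).+1 | t <- gaps A s] = (size s).+1.
Proof.
elim: s => //= x s IH; case: (A x) => /=; first by rewrite IH.
by move: IH; rewrite gaps_head /= !addSn => ->.
Qed.

Lemma gaps_filter A' A s : subpred A' A ->
  gaps A' (filter A s) = map (filter A) (gaps A' s).
Proof.
move=> sA; elim: s => //= x s IH; case: ifP => Ax /=; last first.
  have -> : A' x = false by apply: contraFF Ax; exact: sA.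
  by rewrite /= Ax IH gaps_head.
by case: ifP => _ /=; rewrite IH // Ax gaps_head.
Qed.

Lemma gaps_refine A' A s : subpred A' A ->
  gaps A s = flatten (map (gaps A) (gaps A' s)).
Proof.
move=> sA; elim: s => //= x s ->; case: (boolP (A' x)) => [/sA -> //|_].
rewrite [gaps A' s]gaps_head /=; case: (A x) => //=.
by rewrite gaps_head.
Qed.

Lemma eq_in_gaps A A' s : {in s, A =1 A'} -> gaps A s = gaps A' s.
Proof.
elim: s => //= x s IH e; rewrite e ?mem_head // IH // => y ys.
by rewrite e // inE ys orbT.
Qed.

Lemma gaps_pred0 A s : {in s, A =1 pred0} -> gaps A s = [:: s].
Proof.
by move=> /eq_in_gaps ->; elim: s => //= x s ->.
Qed.

Lemma gaps_predT A s : {in s, A =1 predT} -> gaps A s = nseq (size s).+1 [::].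
Proof.
by move=> /eq_in_gaps ->; elim: s => //= x s ->.
Qed.

Lemma mem_gap A s t x : t \in gaps A s -> x \in t -> ~~ A x /\ x \in s.
Proof.
move=> ts xt; apply/andP; have : x \in flatten (gaps A s).
  by apply/flattenP; exists t.
by rewrite flatten_gaps mem_filter.
Qed.

(** In a strictly sorted list, the j-th gap of A consists of the elements outside
    A that are preceded by exactly j elements of A. *)
Lemma nth_gaps (lt : rel T) A s j : transitive lt -> irreflexive lt ->
  sorted lt s ->
  nth [::] (gaps A s) j =
  [seq x <- s | ~~ A x && (count (fun a => A a && lt a x) s == j)].
Proof.
move=> ltT ltI; elim: s j => [|y s IH] j; first by case: j => [|[]].
rewrite [sorted _ _]/= (path_sortedE ltT) => /andP[/allP ys ss].
have antis x : x \in s -> lt x y = false.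
  move=> xs; apply/negP => xy; have := ltI x.
  by rewrite (ltT _ _ _ xy (ys _ xs)).
have cy : count (fun a => A a && lt a y) s = 0.
  apply/eqP; rewrite -leqn0 leqNgt -has_count -all_predC; apply/allP => x xs.
  by rewrite /= antis // andbF.
have E i : [seq x <- s | ~~ A x && (count (fun a => A a && lt a x) (y :: s) == i)]
  = [seq x <- s | ~~ A x && (A y + count (fun a => A a && lt a x) s == i)].
  by apply: eq_in_filter => x xs; rewrite /= ys // andbT.
have Ey : [seq x <- y :: s | ~~ A x && (count (fun a => A a && lt a x) (y :: s) == j)]
  = (if ~~ A y && (0 == j) then [:: y] else [::]) ++ 
    [seq x <- s | ~~ A x && (A y + count (fun a => A a && lt a x) s == j)].
  by rewrite -E /= ltI andbF cy add0n; case: ifP.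
rewrite Ey /=; case: (boolP (A y)) => Ay /=.
  case: j {E Ey} => [|j] /=; last by rewrite IH.
  by rewrite (eq_filter (a2 := pred0)) ?filter_pred0 // => x; rewrite andbF.
case: j {E Ey} => [|j] /=; last first.
  by rewrite nth_behead IH.
by rewrite -nth0 IH.
Qed.

(** Admissible cuts: two elements of s related by r are both in A, or in a common
    gap of A. *)
Definition ok_cut r A s : bool :=
  all (fun x => all (fun y => r x y ==>
     has (fun t => (x \in t) && (y \in t)) (filter A s :: gaps A s)) s) s.

Lemma ok_cutP r A s : reflect
  (forall x y, x \in s -> y \in s -> r x y ->
     exists2 t, t \in filter A s :: gaps A s & (x \in t) && (y \in t))
  (ok_cut r A s).
Proof.
apply: (iffP allP) => [h x y xs ys rxy | h x xs].
  by have /allP/(_ y ys) := h x xs; rewrite rxy => /hasP.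
by apply/allP => y ys; apply/implyP => rxy; apply/hasP; exact: h.
Qed.

Lemma eq_in_ok_cut r A A' s : {in s, A =1 A'} -> ok_cut r A s = ok_cut r A' s.
Proof.
by move=> e; rewrite /ok_cut (eq_in_gaps e) (eq_in_filter e).
Qed.

(** Both sides say that related elements lie in a common part of the
    decomposition of s into A', the traces on A of the gaps of A', and the gaps
    of A. *)
Lemma ok_cut_triple r A' A s : uniq s -> subpred A' A ->
  ok_cut r A s && ok_cut r A' (filter A s) =
  ok_cut r A' s && all (ok_cut r A) (gaps A' s).
Proof.
move=> us sA.
have gF := gaps_filter s sA; have gR := gaps_refine s sA.
have fF : filter A' (filter A s) = filter A' s.
  rewrite -filter_predI; apply: eq_filter => x /=.
  by case: (boolP (A' x)) => //= /sA ->.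
(* related elements are in a common part of the decomposition into three layers *)
pose ok3 := forall x y, x \in s -> y \in s -> r x y ->
   [\/ (x \in filter A' s) && (y \in filter A' s),
     exists2 t, t \in gaps A' s & (x \in filter A t) && (y \in filter A t) |
     exists2 t, t \in gaps A' s & exists2 t', t' \in gaps A t &
        (x \in t') && (y \in t')].
have same t t' x : t \in gaps A' s -> t' \in gaps A' s -> x \in t -> x \in t' ->
    t = t'.
  have : uniq (flatten (gaps A' s)) by rewrite flatten_gaps filter_uniq.
  elim: (gaps A' s) => //= u ss IH; rewrite cat_uniq => /and3P[_ /hasPn d uss].
  have D z : z \in flatten ss -> z \notin u by exact: d.
  rewrite !inE => /predU1P[->|tss] /predU1P[->|tss'] // xt xt'.
  - by have /D : x \in flatten ss by [apply/flattenP; exists t']; rewrite xt.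
  - by have /D : x \in flatten ss by [apply/flattenP; exists t]; rewrite xt'.
  - exact: IH.
have L : ok_cut r A s && ok_cut r A' (filter A s) <-> ok3.
  split=> [/andP[/ok_cutP h1 /ok_cutP h2] x y xs ys rxy|h].
    have [t] := h1 x y xs ys rxy; rewrite inE => /predU1P[->|].
      case/andP=> xA yA; have [t'] := h2 x y xA yA rxy.
      rewrite fF gF inE => /predU1P[->|/mapP[u us' ->]] ?; first exact: Or31.
      by apply: Or32; exists u.
    rewrite gR => /flattenP[_ /mapP[u us' ->] tu] ?; apply: Or33.
    by exists u => //; exists t.
  apply/andP; split; apply/ok_cutP => x y.
    move=> xs ys rxy; case: (h x y xs ys rxy) => [/andP[xA yA]|[t ts] /andP[xA yA]|[t ts] [t' tt'] xy].
    - exists (filter A s); rewrite ?mem_head //.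
      by move: xA yA; rewrite !mem_filter xs ys => /andP[/sA -> _] /andP[/sA -> _].
    - exists (filter A s); rewrite ?mem_head //.
      by move: xA yA; rewrite !mem_filter xs ys => /andP[-> _] /andP[-> _].
    - exists t' => //; rewrite inE gR; apply/orP; right; apply/flattenP.
      by exists (gaps A t) => //; exact: map_f.
  rewrite !mem_filter => /andP[xA xs] /andP[yA ys] rxy.
  rewrite fF gF.
  case: (h x y xs ys rxy) => [xy|[t ts] xy|[t ts] [t' tt'] /andP[xt yt]].
  - by exists (filter A' s); rewrite ?mem_head.
  - by exists (filter A t) => //; rewrite inE map_f ?orbT.
  - by have [] := mem_gap tt' xt; rewrite xA.
have R : ok_cut r A' s && all (ok_cut r A) (gaps A' s) <-> ok3.
  split=> [/andP[/ok_cutP h1 /allP h2] x y xs ys rxy|h].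
    have [t] := h1 x y xs ys rxy; rewrite inE => /predU1P[-> ?|]; first exact: Or31.
    move=> ts /andP[xt yt]; have /ok_cutP/(_ x y xt yt rxy)[u] := h2 t ts.
    rewrite inE => /predU1P[->|ut] ?; first by apply: Or32; exists t.
    by apply: Or33; exists t => //; exists u.
  apply/andP; split; [apply/ok_cutP => x y xs ys rxy|apply/allP => t ts; apply/ok_cutP => x y xt yt rxy].
    case: (h x y xs ys rxy) => [xy|[t ts] |[t ts] [t' tt'] /andP[xt yt]].
    - by exists (filter A' s); rewrite ?mem_head.
    - rewrite !mem_filter => /andP[/andP[_ xt] /andP[_ yt]].
      by exists t; rewrite ?inE ?ts ?orbT ?xt.
    - exists t; rewrite ?inE ?ts ?orbT //.
      by have [_ ->] := mem_gap tt' xt; have [_ ->] := mem_gap tt' yt.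
  have [nx xs] := mem_gap ts xt; have [ny ys] := mem_gap ts yt.
  case: (h x y xs ys rxy) => [|[u uss] xy|[u uss] [t' tt'] /andP[xt' yt']].
  - by rewrite mem_filter (negPf nx).
  - exists (filter A t); rewrite ?mem_head //.
    suff -> : t = u by [].
    apply: (same _ _ x) => //; move: xy; rewrite !mem_filter.
    by case/andP=> /andP[].
  - have [_ xu] := mem_gap tt' xt'; have e := same _ _ x ts uss xt xu.
    by exists t'; rewrite ?xt' // inE e tt' orbT.
by apply/idP/idP => [/L/R|/R/L].
Qed.

End Gaps.

Section GapsMap.
Variables (T T' : eqType) (f : T -> T').
Hypothesis finj : injective f.

Lemma gaps_map (A : pred T') s :
  gaps A (map f s) = map (map f) (gaps (preim f A) s).
Proof.
elim: s => //= x s ->; case: (A (f x)) => //=; rewrite behead_map.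
by congr ((_ :: _) :: _); case: (gaps _ s).
Qed.

Lemma ok_cut_map (r : rel T') (A : pred T') s :
  ok_cut r A (map f s) = ok_cut (relpre f r) (preim f A) s.
Proof.
rewrite /ok_cut all_map; apply: eq_all => x /=; rewrite all_map.
apply: eq_all => y /=; congr (_ ==> _); rewrite gaps_map filter_map.
rewrite !mem_map //; congr (_ || _); rewrite has_map; apply: eq_has => t /=.
by rewrite !mem_map.
Qed.
End GapsMap.

(** * Partitions as matrices *)

Section Codes.

(** The restriction of the relation r to the list s, as a matrix of booleans. *)
Definition rel_matrix (T : Type) (r : rel T) (s : seq T) : seq (seq bool) :=
  [seq [seq r x y | y <- s] | x <- s].

Lemma rel_matrix_map (T T' : Type) (f : T -> T') (r : rel T') s :
  rel_matrix r (map f s) = rel_matrix (relpre f r) s.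
Proof.
by rewrite /rel_matrix -map_comp; apply: eq_map => x /=; rewrite -map_comp.
Qed.

Lemma eq_in_rel_matrix (T : eqType) (r r' : rel T) s :
  {in s &, r =2 r'} -> rel_matrix r s = rel_matrix r' s.
Proof.
by move=> e; apply/eq_in_map => x xs; apply/eq_in_map => y ys; exact: e.
Qed.

Lemma nth_rel_matrix (T : Type) x0 (r : rel T) s i j :
  i < size s -> j < size s ->
  nth false (nth [::] (rel_matrix r s) i) j = r (nth x0 s i) (nth x0 s j).
Proof. by move=> lti ltj; rewrite (nth_map x0) // (nth_map x0). Qed.

(** The equivalence relation whose classes are the blocks of P. *)
Definition same_block n (P : {set {set 'I_n}}) : rel 'I_n :=
  fun x y => [exists V in P, (x \in V) && (y \in V)].

Section Partition.
Variables (n : nat) (P : {set {set 'I_n}}).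
Hypothesis ncP : is_nc P.

Lemma nc_trivI : trivIset P.
Proof. by have /andP[/and3P[]] := ncP. Qed.

Lemma block_ex x : exists2 V, V \in P & x \in V.
Proof.
have /andP[/and3P[/eqP e _ _] _] := ncP.
by have : x \in cover P; [rewrite e inE | move/bigcupP=> [V]; exists V].
Qed.

Lemma block_neq0 V : V \in P -> exists x, x \in V.
Proof.
have /andP[/and3P[_ _ P0] _] := ncP.
by move=> VP; apply/set0Pn; apply: contraNneq P0 => <-.
Qed.

Lemma block_uniq V W x : V \in P -> W \in P -> x \in V -> x \in W -> V = W.
Proof.
move=> VP WP xV xW; apply/eqP; apply: contraT => ne.
have /trivIsetP/(_ V W VP WP ne) := nc_trivI.
by move=> /disjointFr/(_ xV); rewrite xW.
Qed.

Lemma noncrossingP V W a b c d : V \in P -> W \in P -> V != W ->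
  a \in V -> c \in V -> b \in W -> d \in W -> a < b -> b < c -> c < d -> False.
Proof.
have /andP[_ /forall_inP h] := ncP => VP WP ne aV cV bW dW ab bc cd.
have /forall_inP/(_ W WP)/implyP/(_ ne) := h V VP.
move=> /forall_inP/(_ _ aV)/forall_inP/(_ _ cV).
by move=> /forall_inP/(_ _ bW)/forall_inP/(_ _ dW); rewrite ab bc cd.
Qed.

Lemma same_blockP V x y : V \in P -> x \in V -> same_block P x y = (y \in V).
Proof.
move=> VP xV; apply/exists_inP/idP => [[W WP /andP[xW yW]]|yV].
  by rewrite (block_uniq VP WP xV xW).
by exists V; rewrite ?xV.
Qed.

Lemma same_block_sets : P = [set [set y | same_block P x y] | x : 'I_n].
Proof.
apply/setP => V; apply/idP/imsetP => [VP|[x _ ->]].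
  have [x xV] := block_neq0 VP; exists x => //.
  by apply/setP => y; rewrite inE (same_blockP y VP xV).
have [W WP xW] := block_ex x; suff -> : [set y | same_block P x y] = W by [].
by apply/setP => y; rewrite inE (same_blockP y WP xW).
Qed.
End Partition.

(** A partition, encoded as the matrix of its equivalence relation.  Codes of
    partitions of different sizes live in one type, which spares casts. *)
Definition code (p : ncletter) : seq (seq bool) :=
  rel_matrix (same_block (blocks p)) (enum 'I_(tag p)).

Lemma size_code p : size (code p) = tag p.
Proof. by rewrite size_map size_enum_ord. Qed.

Lemma code_inj : injective code.
Proof.
move=> [n P] [m Q] e; have := congr1 size e; rewrite !size_code /= => e'.
subst m; congr existT; apply: val_inj.
rewrite (same_block_sets (valP P)) (same_block_sets (valP Q)).
suff E x y : same_block (val P) x y = same_block (val Q) x y.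
  by apply: eq_imset => x; apply/setP => y; rewrite !inE E.
have := congr1 (fun c => nth false (nth [::] c x) y) e.
by rewrite !(nth_rel_matrix x) ?size_enum_ord //= !nth_ord_enum.
Qed.

(** The partition whose equivalence relation is r along the list s; by convention
    the empty partition when there is none. *)
Definition std (T : Type) (r : rel T) (s : seq T) : ncletter :=
  if [pick P : NC (size s) |
       code (Tagged (fun n => NC n : Type) P) == rel_matrix r s] is Some P
  then Tagged (fun n => NC n : Type) P else nc_empty.

(** The restriction of r to s is the equivalence relation of a non-crossing
    partition. *)
Definition good (T : Type) (r : rel T) (s : seq T) : Prop :=
  code (std r s) = rel_matrix r s.

Lemma std_code (T : Type) (r : rel T) s p :
  code p = rel_matrix r s -> std r s = p.
Proof.
case: p => n P e; have := congr1 size e; rewrite size_code size_map /= => en.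
subst n; rewrite /std; case: pickP => [Q /eqP eQ|/(_ P)]; last first.
  by rewrite e eqxx.
by apply: code_inj; rewrite e.
Qed.

Lemma code_good (T : Type) (r : rel T) s p : code p = rel_matrix r s -> good r s.
Proof. by move=> e; rewrite /good (std_code e). Qed.

Lemma good_tag (T : Type) (r : rel T) s : good r s -> tag (std r s) = size s.
Proof. by move=> h; rewrite -size_code h size_map. Qed.

Lemma code_empty : code nc_empty = [::].
Proof. by apply/nilP; rewrite /nilp size_code. Qed.

Lemma std_nil (T : Type) (r : rel T) : std r [::] = nc_empty.
Proof. by apply: std_code; exact: code_empty. Qed.

Lemma nc_emptyP p : (p == nc_empty) = (tag p == 0).
Proof.
apply/eqP/eqP => [->//|e]; apply: code_inj; rewrite code_empty.
by apply/nilP; rewrite /nilp size_code e.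
Qed.

Lemma std_empty (T : Type) (r : rel T) s : good r s ->
  (std r s == nc_empty) = nilp s.
Proof. by move=> h; rewrite nc_emptyP good_tag. Qed.

(** Renumbering the blocks in S amounts to restricting the equivalence relation
    to the elements they cover. *)
Lemma code_subpart (p : ncletter) (S : {set {set 'I_(tag p)}}) :
  code (subpart S) =
  rel_matrix (same_block (blocks p)) (enum (cover (blocks p :&: S))).
Proof.
set Q := blocks p :&: S.
have -> : code (subpart S) =
  rel_matrix (same_block (renumber Q)) (enum 'I_#|cover Q|) by [].
rewrite -[enum (cover Q)](map_tnth_enum (enum_tuple (mem (cover Q)))).
rewrite [RHS]rel_matrix_map; apply: eq_in_rel_matrix => i j _ _ /=.
have evE k : @enum_val _ (mem (cover Q)) k = tnth (enum_tuple (mem (cover Q))) k.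
  by rewrite (tnth_nth (enum_val k)) -enum_val_nth.
rewrite -!evE; apply/exists_inP/exists_inP => [[_ /imsetP[V VQ ->]]|[V VP ij]].
  by rewrite !inE => ij; exists V => //; move: VQ; rewrite inE => /andP[].
exists ((fun i => @enum_val _ (mem (cover Q)) i) @^-1: V); last by rewrite !inE.
apply: imset_f; have /bigcupP[W WQ iW] := enum_valP i.
have WP : W \in blocks p by move: WQ; rewrite inE => /andP[].
by have [iV _] := andP ij; rewrite (block_uniq (valP (tagged p)) VP WP iV iW).
Qed.
End Codes.

(** * Cuts of a partition as subsets *)

Section CutsOn.

(** Whether the first element of s is in A. *)
Definition hd_in (T : Type) (A : pred T) (s : seq T) : bool :=
  if s is x :: _ then A x else false.

(** The cuts of p for which the truth value of 1 being in L satisfies Q.  All cuts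
    and both kinds of half-cuts are instances. *)
Definition cuts_on (Q : pred bool) (p : ncletter) :=
  [seq (lower L, upper L) | L <- enum [set L | lowerset L & Q (@one_in p L)]].

Lemma cuts_on_predT p : cuts_on predT p = cuts p.
Proof.
rewrite /cuts_on /cuts; congr map; apply: eq_enum => L.
by rewrite !inE andbT.
Qed.

Lemma cuts_on_half p b : cuts_on (eq_op^~ b) p = half_cuts p b.
Proof. by []. Qed.

(** The lower and upper parts of the cut of s by A. *)
Definition cut_of (T : finType) (r : rel T) s (A : {set T}) :=
  (std r (filter (mem A) s), map (std r) (gaps (mem A) s)).

(** The subsets A of s that are admissible cuts, with a condition Q on whether the
    first element of s is in A. *)
Definition cut_sets (T : finType) (r : rel T) s (Q : pred bool) :=
  [set A : {set T} | [&& A \subset s, ok_cut r (mem A) s & Q (hd_in (mem A) s)]].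

Section Base.
Variable p : ncletter.
Local Notation n := (tag p).
Local Notation r := (same_block (blocks p)).
Local Notation s := (enum 'I_n).
Implicit Types (A : {set 'I_n}) (L : {set {set 'I_n}}).

Let ncp : is_nc (blocks p) := valP (tagged p).

(** The number of elements of A below x. *)
Definition before A (x : 'I_n) : nat := #|[set a in A | a < x]|.

Lemma before_count A x : before A x = count (fun a => (a \in A) && (a < x)) s.
Proof. by rewrite /before cardsE cardE size_filter enumT. Qed.

(** The gaps of a subset of 'I_n are the gaps of the increasing list of all
    elements. *)
Lemma enum_gap A j :
  enum (gap A j) = nth [::] (gaps (mem A) s) j.
Proof.
rewrite (@nth_gaps _ (fun a b : 'I_n => a < b)).
- rewrite {1}/enum_mem -enumT; apply: eq_filter => x.
  by rewrite !inE; congr (_ && (_ == _)); exact: before_count.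
- by move=> a b c; exact: ltn_trans.
- by move=> a; exact: ltnn.
- by have := iota_ltn_sorted 0 n; rewrite -val_enum_ord sorted_map.
Qed.

Lemma count_set A : count (mem A) s = #|A|.
Proof. by rewrite cardE size_filter enumT. Qed.

Lemma filter_set A : filter (mem A) s = enum A.
Proof. by rewrite {2}/enum_mem -enumT. Qed.

Lemma gaps_enum A : gaps (mem A) s = [seq enum (gap A j) | j <- iota 0 #|A|.+1].
Proof.
have szg : size (gaps (mem A) s) = #|A|.+1 by rewrite size_gaps count_set.
apply: (@eq_from_nth _ [::]); first by rewrite szg size_map size_iota.
rewrite szg => j ltj; rewrite (nth_map 0) ?size_iota // nth_iota // add0n.
exact/esym/enum_gap.
Qed.

Lemma ok_cut_enumP A : reflect
  (forall x y, r x y -> (x \in A) && (y \in A) ||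
      [&& x \notin A, y \notin A & before A x == before A y])
  (ok_cut r (mem A) s).
Proof.
apply: (iffP (ok_cutP _ _ _)) => [h x y rxy|h x y _ _ rxy].
  have [t] := h x y (mem_enum _ _) (mem_enum _ _) rxy.
  rewrite filter_set gaps_enum inE => /predU1P[->|/mapP[j _ ->]].
    by rewrite !mem_enum => ->.
  by rewrite !mem_enum !inE => /and3P[/andP[-> /eqP ex] -> /eqP ey]; rewrite /before ex ey eqxx orbT.
case/orP: (h x y rxy) => [xy|/and3P[xA yA /eqP e]].
  by exists (enum A); rewrite ?filter_set ?mem_head // !mem_enum.
exists (enum (gap A (before A x))).
2: by rewrite !mem_enum !inE xA yA /= eqxx; apply/eqP/esym.
rewrite gaps_enum inE; apply/orP; right; apply/mapP; exists (before A x) => //.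
rewrite mem_iota add0n ltnS /= subset_leq_card //.
by apply/subsetP => a; rewrite inE => /andP[].
Qed.

(** A block outside a lowerset L lies in a single gap of L: otherwise a block of L
    would have an element between two of its elements, hence, by non-crossing,
    be nested in it, which would put it in L. *)
Lemma lowerset_ok L : lowerset L -> ok_cut r (mem (cover L)) s.
Proof.
case/andP=> sL /forall_inP lowL; apply/ok_cut_enumP.
have coverE V x : V \in blocks p -> x \in V -> (x \in cover L) = (V \in L).
  move=> VP xV; apply/bigcupP/idP => [[W WL xW]|VL]; last by exists V.
  by rewrite (block_uniq ncp VP (subsetP sL _ WL) xV xW).
(* no element of L lies between two elements x, y of a block outside L *)
have key (x y a : 'I_n) V : V \in blocks p -> x \in V -> y \in V -> V \notin L ->
    a \in cover L -> x < a -> a < y -> False.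
  move=> VP xV yV VL /bigcupP[W WL aW] xa ay; have WP := subsetP sL _ WL.
  have ne : W != V by apply: contraNneq VL => <-.
  have /forall_inP/(_ V VP)/implyP := lowL W WL.
  suff nWV : nested W V by move=> /(_ nWV); apply/negP.
  rewrite /nested ne; apply/forall_inP => w wW.
  have ntV c : c \in V -> val c = w -> False.
    move=> cV /val_inj e; case/eqP: ne; apply: (block_uniq ncp WP VP wW).
    by rewrite -e.
  apply/andP; split; apply/exists_inP.
    have [lt|le] := leqP x w; first by exists x.
    by case: (noncrossingP ncp WP VP ne wW aW xV yV le xa ay).
  have [lt|le] := leqP w y; first by exists y.
  by case: (noncrossingP ncp VP WP _ xV yV aW wW xa ay le); rewrite eq_sym.
move=> x y /exists_inP[V VP /andP[xV yV]].
rewrite !(coverE V) //; case: (boolP (V \in L)) => //= VL.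
have beq (x' y' : 'I_n) : x' \in V -> y' \in V -> x' < y' ->
    before (cover L) x' = before (cover L) y'.
  move=> xV' yV' lt; apply: eq_card => a; rewrite !inE.
  case: (boolP (a \in cover L)) => //= aL.
  have ax : (a == x' :> nat) = false.
    apply/negP => /eqP/val_inj e; move: aL; rewrite e (coverE V) //.
    by rewrite (negPf VL).
  case: (ltngtP a x') ax => // [lt'|gt] _; first by rewrite (ltn_trans lt').
  by symmetry; apply/negP => lt'; exact: (key x' y' a V).
by case: (ltngtP x y) => [lt|lt|/val_inj ->] //; [rewrite (beq x y)|rewrite (beq y x)].
Qed.

(** The blocks contained in A. *)
Definition blocks_in A : {set {set 'I_n}} := [set V in blocks p | V \subset A].

Lemma cover_blocks_in A : (forall x y, r x y -> (x \in A) = (y \in A)) ->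
  cover (blocks_in A) = A.
Proof.
move=> h; apply/setP => x; apply/bigcupP/idP => [[V]|xA].
  by rewrite inE => /andP[_ /subsetP sV] /sV.
have [V VP xV] := block_ex ncp x; exists V => //; rewrite inE VP.
apply/subsetP => y yV; rewrite -(h x y) // (same_blockP ncp _ VP xV).
by [].
Qed.

Lemma ok_blockP A x y : ok_cut r (mem A) s -> r x y -> (x \in A) = (y \in A).
Proof.
move=> /ok_cut_enumP h /h /orP[/andP[-> ->]//|/and3P[/negPf -> /negPf ->]] //.
Qed.

(** Conversely, if A contains a block nested in a block W disjoint from A, then W
    has elements on both sides of an element of A, and is not in a single gap. *)
Lemma ok_lowerset A : ok_cut r (mem A) s -> lowerset (blocks_in A).
Proof.
move=> okA; apply/andP; split; first by apply/subsetP => V; rewrite inE => /andP[].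
apply/forall_inP => V; rewrite inE => /andP[VP /subsetP VA].
apply/forall_inP => W WP; apply/implyP => /andP[ne /forall_inP h].
have [x xV] := block_neq0 ncp VP.
have /andP[/exists_inP[a aW ax] /exists_inP[b bW xb]] := h x xV.
have rW c d : c \in W -> d \in W -> r c d.
  by move=> cW; rewrite (same_blockP ncp _ WP cW).
suff aA : a \in A.
  by rewrite inE WP; apply/subsetP => c cW; rewrite -(ok_blockP okA (rW a c aW cW)).
apply: contraT => aA; have := elimT (ok_cut_enumP A) okA a b (rW a b aW bW).
rewrite (negPf aA) /= => /andP[_ /eqP e].
have : before A a < before A b.
  apply: proper_card; apply/properP; split.
    apply/subsetP => c; rewrite !inE => /andP[-> ca] /=.
    exact: leq_trans ca (leq_trans ax xb).
  exists x; rewrite !inE VA //=; last by rewrite -leqNgt.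
  rewrite ltn_neqAle xb andbT; apply: contraNneq aA => /val_inj e'.
  by rewrite (ok_blockP okA (rW a b aW bW)) -e' VA.
by rewrite e ltnn.
Qed.

Lemma blocks_in_cover L : L \subset blocks p -> blocks_in (cover L) = L.
Proof.
move=> sL; apply/setP => V; rewrite inE; apply/andP/idP => [[VP VA]|VL].
  have [x xV] := block_neq0 ncp VP; have /bigcupP[W WL xW] := subsetP VA x xV.
  by rewrite (block_uniq ncp VP (subsetP sL _ WL) xV xW).
by split; [exact: (subsetP sL) | exact: bigcup_sup].
Qed.

Lemma one_in_hd L : one_in L = hd_in (mem (cover L)) s.
Proof.
rewrite /one_in /hd_in; case: (enum 'I_n) (val_enum_ord n) => [|x e] /=.
  move=> /(congr1 size); rewrite size_iota => n0.
  by apply/negbTE/negP => /exists_inP[k]; have := ltn_ord k; rewrite -{2}n0.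
move=> /(congr1 (head 0)) /= x0; have {}x0 : x = 0 :> nat.
  by rewrite x0; case: (n).
apply/exists_inP/idP => [[i iL /eqP i0]|xL].
  by rewrite (_ : x = i) //; apply: val_inj; rewrite /= x0.
by exists x; rewrite ?x0.
Qed.

Lemma code_lower L : L \subset blocks p ->
  code (lower L) = rel_matrix r (filter (mem (cover L)) s).
Proof.
by move=> sL; rewrite /lower code_subpart (setIidPr sL) filter_set.
Qed.

Lemma code_gap A j : ok_cut r (mem A) s ->
  code (subpart [set V : {set 'I_n} | V \subset gap A j]) =
  rel_matrix r (enum (gap A j)).
Proof.
move=> okA; rewrite code_subpart.
have -> : blocks p :&: [set V : {set 'I_n} | V \subset gap A j] =
    blocks_in (gap A j) by apply/setP => V; rewrite !inE.
rewrite cover_blocks_in //.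
move=> x y /(elimT (ok_cut_enumP A) okA); rewrite !inE.
by case/orP => [/andP[-> ->]//|/and3P[-> -> /eqP e]]; congr (_ == j).
Qed.

Lemma cut_base L : lowerset L -> (lower L, upper L) = cut_of r s (cover L).
Proof.
move=> lowL; have okL := lowerset_ok lowL; have /andP[sL _] := lowL.
rewrite /cut_of (std_code (code_lower sL)); congr pair.
rewrite gaps_enum -map_comp; apply: eq_map => j /=.
by rewrite (std_code (code_gap j okL)).
Qed.

(** The parts of an admissible cut of a partition are non-crossing partitions. *)
Lemma good_base A : ok_cut r (mem A) s ->
  good r (filter (mem A) s) /\ {in gaps (mem A) s, forall t, good r t}.
Proof.
move=> okA; split.
  have cA := cover_blocks_in (A := A) (fun x y => ok_blockP okA).
  have sA : blocks_in A \subset blocks p.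
    by apply/subsetP => V; rewrite inE => /andP[].
  by have := code_good (code_lower sA); rewrite cA.
move=> t; rewrite gaps_enum => /mapP[j _ ->].
exact: code_good (code_gap j okA).
Qed.

Lemma cuts_on_base Q :
  perm_eq (cuts_on Q p) [seq cut_of r s A | A <- enum (cut_sets r s Q)].
Proof.
have -> : cuts_on Q p = map (cut_of r s) (map cover (enum [set L | lowerset L & Q (@one_in p L)])).
  rewrite -map_comp; apply/eq_in_map => L; rewrite mem_enum inE => /andP[+ _].
  exact: cut_base.
apply: perm_map; apply: uniq_perm; last 2 first.
- exact: enum_uniq.
- move=> A; rewrite mem_enum inE; apply/mapP/and3P => [[L]|[_ okA QA]].
    rewrite mem_enum inE => /andP[lowL QL] ->; split.
    + by apply/subsetP => x; rewrite mem_enum.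
    + exact: lowerset_ok.
    + by rewrite -one_in_hd.
  have cA := cover_blocks_in (A := A) (fun x y => ok_blockP okA).
  by exists (blocks_in A) => //; rewrite mem_enum inE ok_lowerset // one_in_hd cA.
rewrite map_inj_in_uniq ?enum_uniq // => L L'; rewrite !mem_enum !inE.
move=> /andP[/andP[sL _] _] /andP[/andP[sL' _] _] e.
by rewrite -(blocks_in_cover sL) -(blocks_in_cover sL') e.
Qed.
End Base.

Section Transfer.
Variables (T : finType) (r : rel T) (s : seq T) (p : ncletter).
Hypotheses (us : uniq s) (cp : code p = rel_matrix r s).

(** A list with the same matrix as p is the image of the positions of p under an
    injection that transports the relation. *)
Lemma code_iso : exists2 f : 'I_(tag p) -> T, injective f &
  s = map f (enum 'I_(tag p)) /\ relpre f r =2 same_block (blocks p).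
Proof.
have sz : size s == tag p by rewrite -size_code cp size_map.
exists (tnth (Tuple sz)).
  by apply/injectiveP; rewrite /injectiveb /dinjectiveb map_tnth_enum.
split=> [|x y /=]; first by rewrite map_tnth_enum.
have := congr1 (fun c => nth false (nth [::] c x) y) cp.
have ltx := ltn_ord x; have lty := ltn_ord y.
rewrite (nth_rel_matrix x) ?size_enum_ord // !nth_ord_enum => ->.
pose x0 := tnth (Tuple sz) x.
by rewrite (nth_rel_matrix x0) ?(eqP sz) // !(tnth_nth x0).
Qed.

Lemma good_cut (A : {set T}) : ok_cut r (mem A) s ->
  good r (filter (mem A) s) /\ {in gaps (mem A) s, forall t, good r t}.
Proof.
have [f finj [es rf]] := code_iso; rewrite es ok_cut_map //.
set A0 := [set x | f x \in A].
have eA : preim f (mem A) =1 mem A0 by move=> x; rewrite /= inE.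
have okE : ok_cut (relpre f r) (preim f (mem A)) (enum 'I_(tag p)) =
           ok_cut (same_block (blocks p)) (mem A0) (enum 'I_(tag p)).
  rewrite (eq_in_ok_cut _ (in1W eA)); apply: eq_all => x; apply: eq_all => y.
  by rewrite rf.
have gm t : good (same_block (blocks p)) t -> good r (map f t).
  move=> gt; apply: (@code_good _ _ _ (std (same_block (blocks p)) t)).
  by rewrite gt rel_matrix_map; apply: eq_in_rel_matrix => x y _ _; rewrite -rf.
rewrite okE => /good_base[g1 g2]; split.
  by rewrite filter_map (eq_filter eA); exact: gm.
move=> u; rewrite gaps_map (eq_in_gaps (in1W eA)) => /mapP[t tg ->].
exact/gm/g2.
Qed.

(** The cuts of p, described by the subsets of any list that carries a copy of p.
    The freedom in the choice of the list is what allows cuts to be iterated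
    without renumbering. *)
Lemma cuts_onP Q :
  perm_eq (cuts_on Q p) [seq cut_of r s A | A <- enum (cut_sets r s Q)].
Proof.
apply: (perm_trans (cuts_on_base p Q)).
have [f finj [es rf]] := code_iso.
have stdE t : good (same_block (blocks p)) t -> std r (map f t) = std (same_block (blocks p)) t.
  move=> gt; apply: std_code; rewrite gt rel_matrix_map.
  by apply: eq_in_rel_matrix => x y _ _; rewrite -rf.
have eA (A : {set 'I_(tag p)}) : preim f (mem (f @: A)) =1 mem A.
  by move=> x; rewrite /= mem_imset.
have okE (A : {set 'I_(tag p)}) : ok_cut r (mem (f @: A)) s =
           ok_cut (same_block (blocks p)) (mem A) (enum 'I_(tag p)).
  rewrite es ok_cut_map // (eq_in_ok_cut _ (in1W (eA A))).
  by apply: eq_all => x; apply: eq_all => y; rewrite rf.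
have hdE (A : {set 'I_(tag p)}) : hd_in (mem (f @: A)) s = hd_in (mem A) (enum 'I_(tag p)).
  by rewrite es; case: (enum _) => //= x _; rewrite mem_imset.
have -> : [seq cut_of (same_block (blocks p)) (enum 'I_(tag p)) A
            | A <- enum (cut_sets (same_block (blocks p)) (enum 'I_(tag p)) Q)] =
  map (cut_of r s) (map (fun A : {set 'I_(tag p)} => f @: A) (enum (cut_sets (same_block (blocks p)) (enum 'I_(tag p)) Q))).
  rewrite -map_comp; apply/eq_in_map => A; rewrite mem_enum inE => /and3P[_ okA _].
  have [g1 g2] := good_base okA.
  rewrite /cut_of /= es filter_map (gaps_map f) (eq_filter (eA A)).
  rewrite (eq_in_gaps (in1W (eA A))) stdE //; congr pair.
  by rewrite -map_comp; apply/eq_in_map => t tg /=; rewrite stdE //; exact: g2.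
apply: perm_map; apply: uniq_perm.
- rewrite map_inj_uniq ?enum_uniq //; exact: imset_inj.
- exact: enum_uniq.
move=> A; rewrite mem_enum inE; apply/mapP/and3P => [[B]|[/subsetP sA okA QA]].
  rewrite mem_enum inE => /and3P[_ okB QB] ->; rewrite okE hdE; split=> //.
  by apply/subsetP => _ /imsetP[x _ ->]; rewrite es map_f ?mem_enum.
have e : A = f @: [set x | f x \in A].
  apply/setP => y; apply/idP/imsetP => [yA|[x + ->]]; last by rewrite inE.
  have := sA y yA; rewrite es => /mapP[x _ e].
  by exists x; rewrite // inE -e.
exists [set x | f x \in A] => //; rewrite mem_enum inE -okE -hdE -e okA QA !andbT.
by apply/subsetP => x; rewrite mem_enum.
Qed.
End Transfer.
End CutsOn.

Import Order.TTheory GRing.Theory.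
Local Open Scope ring_scope.
Local Open Scope quotient_scope.

(** * Coassociativity on a single partition *)

Section Sums.
Variable V : zmodType.

Section Letter.
Variables (T : finType) (r : rel T).
Implicit Types (s : seq T) (ss : seq (seq T)) (A : {set T}).

Lemma sum_cuts_on s p Q (F : ncletter * seq ncletter -> V) :
  uniq s -> code p = rel_matrix r s ->
  \sum_(c <- cuts_on Q p) F c = \sum_(A in cut_sets r s Q) F (cut_of r s A).
Proof.
move=> us cp; rewrite (perm_big _ (cuts_onP us cp Q)) /= big_map.
by rewrite big_enum_cond /=; apply: eq_bigl => A; rewrite andbT.
Qed.

(** Choosing a subset of s and a subset of t is choosing a subset of s ++ t. *)
Lemma sum_subsets_cat s t (P1 P2 : pred {set T}) (G : {set T} -> {set T} -> V) :
  uniq (s ++ t) ->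
  \sum_(A1 : {set T} | (A1 \subset s) && P1 A1)
    \sum_(A2 : {set T} | (A2 \subset t) && P2 A2) G A1 A2 =
  \sum_(A : {set T} | [&& A \subset s ++ t, P1 (A :&: [set x in s])
                        & P2 (A :&: [set x in t])])
     G (A :&: [set x in s]) (A :&: [set x in t]).
Proof.
rewrite cat_uniq => /and3P[_ /hasPn st _]; rewrite pair_big /=.
rewrite (reindex_onto (fun A => (A :&: [set x in s], A :&: [set x in t]))
                      (fun u : {set T} * {set T} => u.1 :|: u.2)) /=.
  apply: eq_bigl => A; have -> : A :&: [set x in s] \subset s.
    by apply/subsetP => x; rewrite !inE => /andP[].
  have -> : A :&: [set x in t] \subset t.
    by apply/subsetP => x; rewrite !inE => /andP[].
  rewrite -setIUr /= andbC; congr andb; apply/eqP/subsetP => [<- x|sA].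
    by rewrite !inE mem_cat => /andP[].
  by apply/setP => x; rewrite !inE; apply/andb_idr => /sA; rewrite mem_cat.
move=> [A1 A2] /= /andP[/andP[/subsetP s1 _] /andP[/subsetP s2 _]].
congr pair; apply/setP => x; rewrite !inE.
  apply/andP/idP => [[/orP[//|/s2 /st /= xs]]|x1]; last by rewrite x1 s1.
  by rewrite (negPf xs).
apply/andP/idP => [[/orP[/s1|//] /=]|x2]; last by rewrite x2 s2 ?orbT.
by move=> xs /st; rewrite /= xs.
Qed.

(** The lower and upper words of the cut by A of a word of partitions, given as
    lists of positions. *)
Definition cut_of_word ss A : seq ncletter * seq ncletter :=
  ([seq std r (filter (mem A) s) | s <- ss],
   flatten [seq map (std r) (gaps (mem A) s) | s <- ss]).

(** The subsets that cut each list of ss, with a condition Q on whether the first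
    element of the first list is in A. *)
Definition word_cut_sets ss (Q : pred bool) :=
  [set A : {set T} | [&& A \subset flatten ss, all (ok_cut r (mem A)) ss
                       & Q (hd_in (mem A) (head [::] ss))]].

Lemma mem_setI_on s A : {in s, mem (A :&: [set x in s]) =1 mem A}.
Proof. by move=> x xs; rewrite /= !inE xs andbT. Qed.

(** The cuts of a word for which the truth value of 1 being in L, in the first
    letter, satisfies Q. *)
Definition wcuts_on (Q : pred bool) (w : seq ncletter) :=
  if w is p :: w' then
    [seq (c.1 :: d.1, c.2 ++ d.2) | c <- cuts_on Q p, d <- word_cuts w']
  else [:: ([::], [::])].

Lemma sum_wcuts_step s ss p w Q (F : seq ncletter * seq ncletter -> V) :
  uniq (flatten (s :: ss)) -> code p = rel_matrix r s ->
  (forall F : seq ncletter * seq ncletter -> V,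
     \sum_(c <- word_cuts w) F c =
     \sum_(A : {set T} | (A \subset flatten ss) && all (ok_cut r (mem A)) ss)
        F (cut_of_word ss A)) ->
  \sum_(c <- wcuts_on Q (p :: w)) F c =
  \sum_(A in word_cut_sets (s :: ss) Q) F (cut_of_word (s :: ss) A).
Proof.
move=> uss cp IH; rewrite /wcuts_on big_allpairs_dep /=.
have us : uniq s by move: uss; rewrite /= cat_uniq => /and3P[].
under eq_bigr => c _ do rewrite (IH (fun d => F (c.1 :: d.1, c.2 ++ d.2))).
rewrite (sum_cuts_on _ _ us cp) /=.
transitivity (\sum_(A1 : {set T} | (A1 \subset s) && (ok_cut r (mem A1) s && Q (hd_in (mem A1) s)))
  \sum_(A2 : {set T} | (A2 \subset flatten ss) && all (ok_cut r (mem A2)) ss)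
   F ((cut_of r s A1).1 :: (cut_of_word ss A2).1, (cut_of r s A1).2 ++ (cut_of_word ss A2).2)).
  by apply: eq_bigl => A; rewrite inE.
rewrite sum_subsets_cat //.
have sub A t : t \in ss -> {in t, mem (A :&: [set x in flatten ss]) =1 mem A}.
  move=> tss x xt; rewrite /= !inE; have -> : x \in flatten ss by apply/flattenP; exists t.
  by rewrite andbT.
apply: eq_big => [A|A _]; last first.
  congr F; rewrite /cut_of /cut_of_word /=; congr pair; [congr cons|congr cat].
  - by rewrite (eq_in_filter (@mem_setI_on s A)).
  - by apply/eq_in_map => t tss; rewrite (eq_in_filter (sub A t tss)).
  - by rewrite (eq_in_gaps (@mem_setI_on s A)).
  - by congr flatten; apply/eq_in_map => t tss; rewrite (eq_in_gaps (sub A t tss)).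
rewrite inE /= (eq_in_ok_cut _ (@mem_setI_on s A)).
have -> : hd_in (mem (A :&: [set x in s])) s = hd_in (mem A) s.
  by case: (s) (@mem_setI_on s A) => //= x s' -> //; rewrite mem_head.
have -> : all (ok_cut r (mem (A :&: [set x in flatten ss]))) ss = all (ok_cut r (mem A)) ss.
  by apply: eq_in_all => t tss; exact: eq_in_ok_cut (sub A t tss).
by rewrite -!andbA; congr (_ && (_ && _)); rewrite andbC.
Qed.

Lemma sum_word_cuts ss w (F : seq ncletter * seq ncletter -> V) :
  uniq (flatten ss) -> map code w = map (rel_matrix r) ss ->
  \sum_(c <- word_cuts w) F c =
  \sum_(A : {set T} | (A \subset flatten ss) && all (ok_cut r (mem A)) ss)
      F (cut_of_word ss A).
Proof.
elim: ss w F => [|s ss IH] [|p w] F //=.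
  move=> _ _; rewrite big_seq1 (big_pred1 set0) // => A.
  rewrite andbT; apply/subsetP/eqP => [h|-> x]; last by rewrite inE.
  by apply/setP => x; rewrite inE; apply/negP => /h.
move=> uss [cp cw]; have uss' : uniq (flatten ss) by move: uss; rewrite cat_uniq => /and3P[].
have := @sum_wcuts_step s ss p w predT F uss cp (fun F => IH w F uss' cw).
rewrite /= cuts_on_predT => ->; apply: eq_bigl => A.
by rewrite inE /= andbT.
Qed.

Lemma sum_wcuts_on s ss w Q (F : seq ncletter * seq ncletter -> V) :
  uniq (flatten (s :: ss)) -> map code w = map (rel_matrix r) (s :: ss) ->
  \sum_(c <- wcuts_on Q w) F c =
  \sum_(A in word_cut_sets (s :: ss) Q) F (cut_of_word (s :: ss) A).
Proof.
case: w => //= p w uss [cp cw]; apply: sum_wcuts_step => // F'.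
by apply: sum_word_cuts => //; move: uss; rewrite /= cat_uniq => /and3P[].
Qed.

End Letter.

(** Compatibility of conditions on the position 1 with the two ways of enumerating
    nested cuts A' <= A: Q1 and Q2 are the conditions for the cut by A followed by
    the cut of its lower part, Q1' and Q2' those for the cut by A' followed by the
    cut of the first letter of its upper part. *)
Definition color_coassoc (Q1 Q2 Q1' Q2' : pred bool) : Prop :=
  forall (T : eqType) (A' A : pred T) (s : seq T), subpred A' A ->
    Q1 (hd_in A s) && Q2 (hd_in A' (filter A s)) =
    Q1' (hd_in A' s) && Q2' (hd_in A (head [::] (gaps A' s))).

Lemma color_coassocT : color_coassoc predT predT predT predT.
Proof. by []. Qed.

(** Position 1 in A'. *)
Lemma color_coassoc_fst :
  color_coassoc (eq_op^~ true) (eq_op^~ true) (eq_op^~ true) predT.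
Proof.
move=> T A' A [|x s] sA //=; rewrite andbT.
case: (boolP (A' x)) => [A'x|nA'].
  by rewrite (sA _ A'x) /= A'x.
by case: (A x) => //=; rewrite (negPf nA').
Qed.

(** Position 1 in A but not in A'. *)
Lemma color_coassoc_mid :
  color_coassoc (eq_op^~ true) (eq_op^~ false) (eq_op^~ false) (eq_op^~ true).
Proof.
move=> T A' A [|x s] sA //=; case: (boolP (A x)) => Ax /=.
  by case: (A' x) => //=; rewrite Ax.
by case: (boolP (A' x)) => //= _; rewrite (negPf Ax).
Qed.

(** Position 1 outside A. *)
Lemma color_coassoc_lst :
  color_coassoc (eq_op^~ false) predT (eq_op^~ false) (eq_op^~ false).
Proof.
move=> T A' A [|x s] sA //=; rewrite andbT.
case: (boolP (A' x)) => [A'x|nA']; first by rewrite (sA _ A'x).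
by rewrite /=; case: (A x).
Qed.

(** Coassociativity of the coproduct on a partition, restricted to the nested cuts
    that satisfy a condition on the position 1. *)
Lemma coassoc_letter Q1 Q2 Q1' Q2' p
    (F : ncletter -> seq ncletter -> seq ncletter -> V) :
  color_coassoc Q1 Q2 Q1' Q2' ->
  \sum_(c <- cuts_on Q1 p) \sum_(d <- cuts_on Q2 c.1) F d.1 d.2 c.2 =
  \sum_(c <- cuts_on Q1' p) \sum_(d <- wcuts_on Q2' c.2) F c.1 d.1 d.2.
Proof.
move=> HQ; set r := same_block (blocks p); set s := enum 'I_(tag p).
have us : uniq s := enum_uniq _.
have cp : code p = rel_matrix r s by [].
rewrite !(sum_cuts_on _ _ us cp).
transitivity (\sum_(A in cut_sets r s Q1) \sum_(A' in cut_sets r (filter (mem A) s) Q2)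
   F (std r (filter (mem A') s)) (map (std r \o filter (mem A)) (gaps (mem A') s))
     (map (std r) (gaps (mem A) s))).
  apply: eq_bigr => A; rewrite inE => /and3P[_ okA _].
  have [gA _] := good_cut us cp okA.
  rewrite (sum_cuts_on _ _ (filter_uniq _ us) gA) /=.
  apply: eq_bigr => A'; rewrite inE => /and3P[/subsetP sA' _ _].
  have sub : subpred (mem A') (mem A).
    by move=> x /sA'; rewrite mem_filter => /andP[].
  rewrite gaps_filter // -map_comp -filter_predI; congr F; congr std.
  by apply: eq_filter => x /=; case: (boolP (x \in A')) => //= /sub /= ->.
have nested_cuts (A A' : {set 'I_(tag p)}) : (A \in cut_sets r s Q1) && (A' \in cut_sets r (filter (mem A) s) Q2) =
  (A' \in cut_sets r s Q1') && [&& A' \subset A, A \subset s, all (ok_cut r (mem A)) (gaps (mem A') s)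
      & Q2' (hd_in (mem A) (head [::] (gaps (mem A') s)))].
  have sT (B : {set 'I_(tag p)}) : B \subset s by apply/subsetP => x; rewrite mem_enum.
  have sE : (A' \subset filter (mem A) s) = (A' \subset A).
    apply/subsetP/subsetP => h x /h; rewrite mem_filter ?mem_enum ?andbT //.
  rewrite !inE !sT sE /=; case: (boolP (A' \subset A)) => [/subsetP sub|_]; last first.
    by rewrite /= !andbF.
  have := HQ _ _ _ s sub; have := ok_cut_triple r us sub => /=.
  (* e, f, g, h stand for the conditions on the first position *)
  have bool4 (a b c d e f g h : bool) : a && b = c && d -> e && f = g && h ->
      (a && e) && (b && f) = (c && g) && (d && h).
    by move=> e1 e2; rewrite andbACA e1 e2 andbACA.
  exact: bool4.
(* sum over A' first; the two sides are then compared for a fixed A' *)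
rewrite (exchange_big_dep (mem (cut_sets r s Q1'))) /=; last first.
  by move=> A A' h1 h2; have := nested_cuts A A'; rewrite h1 h2 => /esym /andP[].
apply: eq_bigr => A' hA'.
have [_ okA' _] : [/\ A' \subset s, ok_cut r (mem A') s & Q1' (hd_in (mem A') s)].
  by apply/and3P; move: hA'; rewrite inE.
have [_ gG] := good_cut us cp okA'.
have fg : flatten (gaps (mem A') s) = filter (predC (mem A')) s by exact: flatten_gaps.
have cw : map code (map (std r) (gaps (mem A') s)) =
    map (rel_matrix r) (head [::] (gaps (mem A') s) :: behead (gaps (mem A') s)).
  by rewrite -gaps_head -map_comp; apply/eq_in_map => t /gG.
have uf : uniq (flatten (gaps (mem A') s)) by rewrite fg filter_uniq.
rewrite gaps_head in uf.
rewrite (sum_wcuts_on _ _ uf cw) -gaps_head.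
(* a set A containing A' is determined by B = A minus A', which cuts the gaps of A' *)
rewrite (reindex_onto (fun B : {set 'I_(tag p)} => B :|: A') (fun A => A :\: A')) /=; last first.
  move=> A h; have := nested_cuts A A'; rewrite h => /esym /andP[_ /and4P[sA _ _ _]].
  apply/setP => x; rewrite !inE.
  by case: (boolP (x \in A')) => [/(subsetP sA) ->|_] //=; rewrite orbF.
have gE (B : {set 'I_(tag p)}) t : t \in gaps (mem A') s -> {in t, mem (B :|: A') =1 mem B}.
  move=> tg x xt; have [nx _] := mem_gap tg xt.
  by rewrite /= !inE; move: nx => /= /negPf ->; rewrite orbF.
apply: eq_big => [B|B _]; last first.
  rewrite /cut_of_word /=; congr F.
    by apply/eq_in_map => t tg /=; rewrite (eq_in_filter (gE B t tg)).
  rewrite (@gaps_refine _ (mem A') (mem (B :|: A'))); last by move=> x /=; rewrite inE orbC => ->.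
  rewrite map_flatten -map_comp; congr flatten; apply/eq_in_map => t tg /=.
  by rewrite (eq_in_gaps (gE B t tg)).
rewrite nested_cuts hA' subsetUr inE fg /=.
have -> : B :|: A' \subset s by apply/subsetP => x; rewrite mem_enum.
have -> : ((B :|: A') :\: A' == B) = (B \subset filter (predC (mem A')) s).
  apply/eqP/subsetP => [<- x|h].
    by rewrite !inE mem_filter mem_enum /= andbT => /andP[].
  apply/setP => x; rewrite !inE; apply/andP/idP => [[nx]|xB].
    by rewrite (negPf nx) orbF.
  by have := h x xB; rewrite mem_filter /= xB => /andP[].
rewrite andbC; congr (_ && _).
have hg : head [::] (gaps (mem A') s) \in gaps (mem A') s.
  by rewrite [in X in _ \in X]gaps_head mem_head.
have -> : hd_in (mem (B :|: A')) (head [::] (gaps (mem A') s)) =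
          hd_in (mem B) (head [::] (gaps (mem A') s)).
  by move: (gE B _ hg); case: (head _ _) => //= x t -> //; rewrite mem_head.
rewrite (@eq_in_all _ _ (ok_cut r (mem B))) // => t tg.
exact: eq_in_ok_cut (gE B t tg).
Qed.

End Sums.

(** * Coassociativity and counit on words *)

Section CutMembership.

Lemma cuts_on_sub Q p : {subset cuts_on Q p <= cuts p}.
Proof.
move=> c /mapP[L]; rewrite mem_enum inE => /andP[lowL _] ->.
by apply/mapP; exists L => //; rewrite mem_enum inE.
Qed.

Lemma mem_cuts_on Q p c : c \in cuts_on Q p ->
  exists2 A : {set 'I_(tag p)}, A \in cut_sets (same_block (blocks p)) (enum 'I_(tag p)) Q &
    [/\ c = cut_of (same_block (blocks p)) (enum 'I_(tag p)) A,
        good (same_block (blocks p)) (filter (mem A) (enum 'I_(tag p))) &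
        {in gaps (mem A) (enum 'I_(tag p)), forall t, good (same_block (blocks p)) t}].
Proof.
rewrite (perm_mem (cuts_onP (enum_uniq _) (erefl (code p)) Q)) => /mapP[A].
rewrite mem_enum => hA ->; exists A => //; have := hA; rewrite inE => /and3P[_ okA _].
by have [] := good_cut (enum_uniq _) (erefl (code p)) okA.
Qed.

Lemma half_cuts_fst p c : c \in half_cuts p true -> c.1 != nc_empty.
Proof.
rewrite -cuts_on_half => /mem_cuts_on[A]; rewrite inE => /and3P[_ _ /eqP hA].
move=> [-> gA _]; rewrite std_empty //.
by move: hA; case: (enum _) => //= x s ->.
Qed.

Lemma cuts_snd_cons p c : c \in cuts p -> exists q v, c.2 = q :: v.
Proof.
by move/mapP=> [L _ ->]; rewrite /upper /=; do 2 eexists.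
Qed.

Lemma half_cuts_snd p c q v : p != nc_empty -> c \in half_cuts p false ->
  c.2 = q :: v -> q != nc_empty.
Proof.
move=> pe; rewrite -cuts_on_half => /mem_cuts_on[A]; rewrite inE => /and3P[_ _ /eqP hA].
move=> [-> _ gG]; rewrite /cut_of /= gaps_head /= => -[<- _].
rewrite std_empty; last by apply: gG; rewrite [X in _ \in X]gaps_head mem_head.
have: size (enum 'I_(tag p)) != 0%N by rewrite size_enum_ord -nc_emptyP.
move: hA; by case: (enum _) => //= x s ->.
Qed.

Lemma cuts_arity p c : c \in cuts p ->
  size c.2 = arity c.1 /\ arities c.2 = arity p.
Proof.
rewrite -cuts_on_predT => /mem_cuts_on[A _ [-> gA gG]] /=.
rewrite size_map size_gaps /arity good_tag // size_filter; split=> //.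
rewrite -[X in _ = X.+1](size_enum_ord (tag p)) -(sum_size_gaps (mem A)) /arities -map_comp.
congr sumn; apply/eq_in_map => t tg /=; rewrite /arity good_tag //; exact: gG.
Qed.

Lemma word_cuts_arity w c : c \in word_cuts w ->
  [/\ size c.1 = size w, size c.2 = arities c.1 & arities c.2 = arities w].
Proof.
elim: w c => [|p w IH] c /=; first by rewrite inE => /eqP ->.
case/allpairsP=> -[c1 d] /= [/cuts_arity[s1 a1] /IH[s2 s3 a2] ->] /=.
by rewrite size_cat arities_cat s1 s2 s3 a1 a2.
Qed.

(** The empty partition is grouplike. *)
Lemma cuts_empty : cuts nc_empty = [:: (nc_empty, [:: nc_empty])].
Proof.
have pe := cuts_onP (enum_uniq _) (erefl (code nc_empty)) predT.
rewrite cuts_on_predT in pe.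
suff E : [seq cut_of (same_block (blocks nc_empty)) (enum 'I_(tag nc_empty)) A
   | A <- enum (cut_sets (same_block (blocks nc_empty)) (enum 'I_(tag nc_empty)) predT)] =
   [:: (nc_empty, [:: nc_empty])] by rewrite E in pe; exact: perm_small_eq pe.
have -> : enum 'I_(tag nc_empty) = [::] by apply/nilP; rewrite /nilp size_enum_ord.
have -> : cut_sets (same_block (blocks nc_empty)) [::] predT = [set set0].
  apply/setP => A; rewrite !inE; apply/and3P/eqP => [_|->].
    by apply/setP => -[].
  by split=> //; apply/subsetP => -[].
by rewrite enum_set1 /= /cut_of /= !std_nil.
Qed.

Lemma word_half_cuts_sub b w : {subset word_half_cuts b w <= word_cuts w}.
Proof.
elim: w => //= p w IH c; case: eqP => [->|_].
  move=> /mapP[d /IH dw ->]; rewrite cuts_empty.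
  by apply/allpairsP; exists ((nc_empty, [:: nc_empty]), d); rewrite mem_head.
move=> /allpairsP[[c1 d] /= [cb dw ->]]; apply/allpairsP; exists (c1, d); split=> //=.
by move: cb; rewrite -cuts_on_half; exact: cuts_on_sub.
Qed.

End CutMembership.

Section WordSums.
Variable V : zmodType.

Lemma sum_word_cuts_cat u v (F : seq ncletter * seq ncletter -> V) :
  \sum_(e <- word_cuts (u ++ v)) F e =
  \sum_(e <- word_cuts u) \sum_(e' <- word_cuts v) F (e.1 ++ e'.1, e.2 ++ e'.2).
Proof.
elim: u F => [|p u IH] F /=; first by rewrite big_seq1 /=; apply: eq_bigr => -[].
rewrite !big_allpairs_dep /=; apply: eq_bigr => c _; rewrite IH.
by apply: eq_bigr => d _; apply: eq_bigr => d' _ /=; rewrite catA.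
Qed.

(** Coassociativity on a word p w follows from coassociativity on p, with a
    condition on the position 1, and on w. *)
Lemma coassoc_cons Q1 Q2 Q1' Q2' p w
    (F : seq ncletter -> seq ncletter -> seq ncletter -> V) :
  color_coassoc Q1 Q2 Q1' Q2' ->
  (forall F' : seq ncletter -> seq ncletter -> seq ncletter -> V,
    \sum_(c <- word_cuts w) \sum_(d <- word_cuts c.1) F' d.1 d.2 c.2 =
    \sum_(c <- word_cuts w) \sum_(d <- word_cuts c.2) F' c.1 d.1 d.2) ->
  \sum_(c <- cuts_on Q1 p) \sum_(d <- word_cuts w)
    \sum_(c' <- cuts_on Q2 c.1) \sum_(d' <- word_cuts d.1)
       F (c'.1 :: d'.1) (c'.2 ++ d'.2) (c.2 ++ d.2) =
  \sum_(c <- cuts_on Q1' p) \sum_(d <- word_cuts w)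
    \sum_(e <- wcuts_on Q2' c.2) \sum_(e' <- word_cuts d.2)
       F (c.1 :: d.1) (e.1 ++ e'.1) (e.2 ++ e'.2).
Proof.
move=> HQ IH; under eq_bigr => c _ do rewrite exchange_big.
transitivity (\sum_(c <- cuts_on Q1 p) \sum_(c' <- cuts_on Q2 c.1)
  \sum_(d <- word_cuts w) \sum_(e' <- word_cuts d.2)
    F (c'.1 :: d.1) (c'.2 ++ e'.1) (c.2 ++ e'.2)).
  apply: eq_bigr => c _; apply: eq_bigr => c' _.
  by rewrite (IH (fun x y z => F (c'.1 :: x) (c'.2 ++ y) (c.2 ++ z))).
rewrite (coassoc_letter p (fun x y z =>
  \sum_(d <- word_cuts w) \sum_(e' <- word_cuts d.2)
    F (x :: d.1) (y ++ e'.1) (z ++ e'.2)) HQ).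
by apply: eq_bigr => c _; rewrite exchange_big.
Qed.

Lemma sum_wcuts_on_predT w (F : seq ncletter * seq ncletter -> V) :
  \sum_(c <- wcuts_on predT w) F c = \sum_(c <- word_cuts w) F c.
Proof. by case: w => //= p w; rewrite cuts_on_predT. Qed.

Lemma word_coassoc w (F : seq ncletter -> seq ncletter -> seq ncletter -> V) :
  \sum_(c <- word_cuts w) \sum_(d <- word_cuts c.1) F d.1 d.2 c.2 =
  \sum_(c <- word_cuts w) \sum_(d <- word_cuts c.2) F c.1 d.1 d.2.
Proof.
elim: w F => [|p w IH] F /=; first by rewrite !big_seq1.
rewrite !big_allpairs_dep /=.
under eq_bigr => c _ do under eq_bigr => d _ do rewrite big_allpairs_dep /=.
under [RHS]eq_bigr => c _ do under eq_bigr => d _ do rewrite sum_word_cuts_cat /=.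
have E := coassoc_cons p F color_coassocT IH; rewrite cuts_on_predT in E.
apply: etrans (etrans E _); apply: eq_bigr => c _; apply: eq_bigr => d _.
  by rewrite cuts_on_predT.
exact: sum_wcuts_on_predT.
Qed.

Lemma half_cons b p w : p != nc_empty -> word_half_cuts b (p :: w) =
  [seq (c.1 :: d.1, c.2 ++ d.2) | c <- cuts_on (eq_op^~ b) p, d <- word_cuts w].
Proof. by move=> /negPf /= ->. Qed.

Lemma sum_half_empty b w (F : seq ncletter * seq ncletter -> V) :
  \sum_(c <- word_half_cuts b (nc_empty :: w)) F c =
  \sum_(c <- word_half_cuts b w) F (nc_empty :: c.1, nc_empty :: c.2).
Proof. by rewrite /= eqxx big_map. Qed.

Lemma sum_cuts_empty w (F : seq ncletter * seq ncletter -> V) :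
  \sum_(c <- word_cuts (nc_empty :: w)) F c =
  \sum_(c <- word_cuts w) F (nc_empty :: c.1, nc_empty :: c.2).
Proof. by rewrite /= cuts_empty big_allpairs_dep big_seq1. Qed.

(** The nested cuts with 1 in the lowest of the three layers. *)
Lemma half_coassoc_fst w (F : seq ncletter -> seq ncletter -> seq ncletter -> V) :
  \sum_(c <- word_half_cuts true w) \sum_(d <- word_half_cuts true c.1) F d.1 d.2 c.2 =
  \sum_(c <- word_half_cuts true w) \sum_(d <- word_cuts c.2) F c.1 d.1 d.2.
Proof.
elim: w F => [|p w IH] F; first by rewrite !big_nil.
case: (eqVneq p nc_empty) => [->|pe].
  rewrite !sum_half_empty.
  under eq_bigr => c _ do rewrite sum_half_empty.
  under [RHS]eq_bigr => c _ do rewrite sum_cuts_empty.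
  exact: (IH (fun x y z => F (nc_empty :: x) (nc_empty :: y) (nc_empty :: z))).
rewrite half_cons // !big_allpairs_dep /=.
under [RHS]eq_bigr => c _ do under eq_bigr => d _ do rewrite sum_word_cuts_cat /=.
have E := coassoc_cons p F color_coassoc_fst (word_coassoc w).
apply: etrans (etrans E _); last first.
  by apply: eq_bigr => c _; apply: eq_bigr => d _; exact: sum_wcuts_on_predT.
apply: eq_big_seq => c ch; apply: eq_bigr => d _.
rewrite cuts_on_half in ch; rewrite (negPf (half_cuts_fst ch)).
by rewrite big_allpairs_dep.
Qed.

Lemma sum_half_cat b p c w (F : seq ncletter * seq ncletter -> V) :
  p != nc_empty -> c \in half_cuts p false ->
  \sum_(e <- word_half_cuts b (c.2 ++ w)) F e =
  \sum_(e <- wcuts_on (eq_op^~ b) c.2) \sum_(e' <- word_cuts w)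
     F (e.1 ++ e'.1, e.2 ++ e'.2).
Proof.
move=> pe ch; have cc : c \in cuts p.
  by move: ch; rewrite -cuts_on_half; exact: cuts_on_sub.
have [q [v e]] := cuts_snd_cons cc; rewrite e cat_cons half_cons; last first.
  exact: half_cuts_snd ch e.
rewrite !big_allpairs_dep; apply: eq_bigr => c' _; rewrite sum_word_cuts_cat.
by apply: eq_bigr => d _; apply: eq_bigr => d' _ /=; rewrite catA.
Qed.

(** The nested cuts with 1 in the middle layer. *)
Lemma half_coassoc_mid w (F : seq ncletter -> seq ncletter -> seq ncletter -> V) :
  \sum_(c <- word_half_cuts true w) \sum_(d <- word_half_cuts false c.1) F d.1 d.2 c.2 =
  \sum_(c <- word_half_cuts false w) \sum_(d <- word_half_cuts true c.2) F c.1 d.1 d.2.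
Proof.
elim: w F => [|p w IH] F; first by rewrite !big_nil.
case: (eqVneq p nc_empty) => [->|pe].
  rewrite !sum_half_empty.
  under eq_bigr => c _ do rewrite sum_half_empty.
  under [RHS]eq_bigr => c _ do rewrite sum_half_empty.
  exact: (IH (fun x y z => F (nc_empty :: x) (nc_empty :: y) (nc_empty :: z))).
rewrite !half_cons // !big_allpairs_dep /=.
have := coassoc_cons p F color_coassoc_mid (word_coassoc w) => E.
transitivity (\sum_(c <- cuts_on (eq_op^~ true) p) \sum_(d <- word_cuts w)
    \sum_(c' <- cuts_on (eq_op^~ false) c.1) \sum_(d' <- word_cuts d.1)
       F (c'.1 :: d'.1) (c'.2 ++ d'.2) (c.2 ++ d.2)).
  apply: eq_big_seq => c ch; apply: eq_bigr => d _.
  rewrite cuts_on_half in ch; rewrite (negPf (half_cuts_fst ch)).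
  by rewrite big_allpairs_dep.
rewrite E; apply: eq_big_seq => c ch; apply: eq_bigr => d _.
by rewrite cuts_on_half in ch; rewrite (sum_half_cat _ _ _ pe ch).
Qed.

(** The nested cuts with 1 in the highest layer. *)
Lemma half_coassoc_lst w (F : seq ncletter -> seq ncletter -> seq ncletter -> V) :
  \sum_(c <- word_half_cuts false w) \sum_(d <- word_cuts c.1) F d.1 d.2 c.2 =
  \sum_(c <- word_half_cuts false w) \sum_(d <- word_half_cuts false c.2) F c.1 d.1 d.2.
Proof.
elim: w F => [|p w IH] F; first by rewrite !big_nil.
case: (eqVneq p nc_empty) => [->|pe].
  rewrite !sum_half_empty.
  under eq_bigr => c _ do rewrite sum_cuts_empty.
  under [RHS]eq_bigr => c _ do rewrite sum_half_empty.
  exact: (IH (fun x y z => F (nc_empty :: x) (nc_empty :: y) (nc_empty :: z))).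
rewrite !half_cons // !big_allpairs_dep /=.
have := coassoc_cons p F color_coassoc_lst (word_coassoc w) => E.
transitivity (\sum_(c <- cuts_on (eq_op^~ false) p) \sum_(d <- word_cuts w)
    \sum_(c' <- cuts_on predT c.1) \sum_(d' <- word_cuts d.1)
       F (c'.1 :: d'.1) (c'.2 ++ d'.2) (c.2 ++ d.2)).
  apply: eq_bigr => c _; apply: eq_bigr => d _.
  by rewrite big_allpairs_dep cuts_on_predT.
rewrite E; apply: eq_big_seq => c ch; apply: eq_bigr => d _.
by rewrite cuts_on_half in ch; rewrite (sum_half_cat _ _ _ pe ch).
Qed.

Lemma sum_cuts_split p (F : ncletter * seq ncletter -> V) :
  \sum_(c <- cuts p) F c =
  \sum_(c <- half_cuts p true) F c + \sum_(c <- half_cuts p false) F c.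
Proof.
rewrite !big_map !big_enum_cond /= (bigID (@one_in p)) /=; congr (_ + _).
  by apply: eq_bigl => L; rewrite !inE eqb_id !andbT.
by apply: eq_bigl => L; rewrite !inE eqbF_neg !andbT.
Qed.

(** The cuts of a word are its half-cuts of either kind, except for words of empty
    partitions, which have exactly one cut and no half-cut. *)
Lemma sum_word_cuts_split w (F : seq ncletter * seq ncletter -> V) :
  \sum_(c <- word_cuts w) F c =
  \sum_(c <- word_half_cuts true w) F c + \sum_(c <- word_half_cuts false w) F c
  + (if all (pred1 nc_empty) w then F (w, w) else 0).
Proof.
elim: w F => [|p w IH] F; first by rewrite big_seq1 !big_nil !add0r.
case: (eqVneq p nc_empty) => [->|pe].
  by rewrite !sum_half_empty sum_cuts_empty IH /= eqxx.
rewrite !half_cons // !cuts_on_half /= (negPf pe) addr0 !big_allpairs_dep.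
exact: sum_cuts_split.
Qed.

Lemma sum_cuts_counitr p (F : ncletter * seq ncletter -> V) :
  \sum_(c <- cuts p) (if all (pred1 nc_empty) c.2 then F c else 0) =
  F (p, nseq (arity p) nc_empty).
Proof.
rewrite -cuts_on_predT (sum_cuts_on _ _ (enum_uniq _) (erefl (code p))).
set r := same_block _; set s := enum _.
have gT : gaps (mem [set: 'I_(tag p)]) s = nseq (arity p) [::].
  by rewrite gaps_predT ?size_enum_ord // => x _; rewrite /= inE.
have fT : filter (mem [set: 'I_(tag p)]) s = s.
  by apply/all_filterP/allP => x _; rewrite /= inE.
have okT : ok_cut r (mem [set: 'I_(tag p)]) s.
  by apply/ok_cutP => x y xs ys _; exists s; rewrite ?fT ?mem_head ?xs.
rewrite (bigD1 [set: 'I_(tag p)]) /=; last first.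
  by rewrite inE okT andbT; apply/subsetP => x; rewrite mem_enum.
rewrite gT !map_nseq std_nil all_nseq /= eqxx big1 ?addr0.
  by rewrite /cut_of gT fT map_nseq std_nil (std_code (erefl (code p))).
move=> A; rewrite inE => /andP[/and3P[_ okA _] nA]; case: ifP => // /allP h.
case/eqP: nA; apply/setP => x; rewrite [RHS]inE; apply: contraT => xA.
have [_ gA] := good_cut (enum_uniq _) (erefl (code p)) okA.
have : x \in flatten (gaps (mem A) s) by rewrite flatten_gaps mem_filter /= xA mem_enum.
case/flattenP=> t tg xt; have := h _ (map_f _ tg); rewrite /= std_empty; last exact: gA.
by case: t xt {tg}.
Qed.

Lemma sum_cuts_counitl p (F : ncletter * seq ncletter -> V) :
  \sum_(c <- cuts p) (if c.1 == nc_empty then F c else 0) =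
  F (nc_empty, [:: p]).
Proof.
rewrite -cuts_on_predT (sum_cuts_on _ _ (enum_uniq _) (erefl (code p))).
set r := same_block _; set s := enum _.
have g0 : gaps (mem (set0 : {set 'I_(tag p)})) s = [:: s].
  by apply: gaps_pred0 => x _; rewrite /= inE.
have f0 : filter (mem (set0 : {set 'I_(tag p)})) s = [::].
  by apply/nilP; rewrite /nilp size_filter -leqn0 leqNgt -has_count; apply/hasPn => x _; rewrite /= inE.
have ok0 : ok_cut r (mem (set0 : {set 'I_(tag p)})) s.
  apply/ok_cutP => x y xs ys _; exists s; last by rewrite xs.
  by rewrite g0 !inE eqxx orbT.
rewrite (bigD1 (set0 : {set 'I_(tag p)})) /=; last first.
  by rewrite inE ok0 andbT; apply/subsetP => x; rewrite inE.
rewrite f0 std_nil eqxx big1 ?addr0.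
  by rewrite /cut_of g0 f0 /= std_nil (std_code (erefl (code p))).
move=> A; rewrite inE => /andP[/and3P[_ okA _] nA].
have [gA _] := good_cut (enum_uniq _) (erefl (code p)) okA.
rewrite std_empty // /nilp size_filter; case: ifP => // /eqP h.
case/eqP: nA; apply/setP => x; rewrite [RHS]inE; apply/negbTE.
move: h => /eqP; rewrite -leqn0 leqNgt -has_count => /hasPn; apply.
exact: mem_enum.
Qed.

(** The only cut of w whose upper part consists of empty partitions is (w, empty). *)
Lemma sum_word_cuts_counitr w (F : seq ncletter * seq ncletter -> V) :
  \sum_(c <- word_cuts w) (if all (pred1 nc_empty) c.2 then F c else 0) =
  F (w, nseq (arities w) nc_empty).
Proof.
elim: w F => [|p w IH] F /=; first by rewrite big_seq1.
rewrite big_allpairs_dep /=.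
transitivity (\sum_(c <- cuts p) (if all (pred1 nc_empty) c.2 then
   F (c.1 :: w, c.2 ++ nseq (arities w) nc_empty) else 0)).
  apply: eq_bigr => c _; rewrite -(IH (fun d => if all (pred1 nc_empty) c.2 then F (c.1 :: d.1, c.2 ++ d.2) else 0)).
  apply: eq_bigr => d _; rewrite all_cat.
  by case: (all _ c.2); case: (all _ d.2).
rewrite (sum_cuts_counitr p (fun c => F (c.1 :: w, c.2 ++ nseq (arities w) nc_empty))) /=.
by rewrite -nseqD.
Qed.

(** The only cut of w whose lower part consists of empty partitions is (empty, w). *)
Lemma sum_word_cuts_counitl w (F : seq ncletter * seq ncletter -> V) :
  \sum_(c <- word_cuts w) (if all (pred1 nc_empty) c.1 then F c else 0) =
  F (nseq (size w) nc_empty, w).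
Proof.
elim: w F => [|p w IH] F /=; first by rewrite big_seq1.
rewrite big_allpairs_dep /=.
transitivity (\sum_(c <- cuts p) (if c.1 == nc_empty then
   F (c.1 :: nseq (size w) nc_empty, c.2 ++ w) else 0)).
  apply: eq_bigr => c _; rewrite -(IH (fun d => if c.1 == nc_empty then F (c.1 :: d.1, c.2 ++ d.2) else 0)).
  apply: eq_bigr => d _.
  by case: (c.1 == _); case: (all _ d.1).
by rewrite (sum_cuts_counitl p (fun c => F (c.1 :: nseq (size w) nc_empty, c.2 ++ w))).
Qed.

End WordSums.

(** * The operad of multilinear maps *)

Section RawLinear.
Variables (K : fieldType) (U V : lmodType K) (f : U -> V).
Hypothesis lf : linear f.

HB.instance Definition _ := GRing.isLinear.Build K U V _ f lf.

Lemma linear_fun0 : f 0 = 0. Proof. exact: linear0. Qed.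
Lemma linear_fun_sum (I : Type) (s : seq I) (F : I -> U) :
  f (\sum_(i <- s) F i) = \sum_(i <- s) f (F i).
Proof. exact: linear_sum. Qed.
Lemma linear_funD x y : f (x + y) = f x + f y. Proof. exact: linearD. Qed.
Lemma linear_funB x y : f (x - y) = f x - f y. Proof. exact: linearB. Qed.
Lemma linear_funZ a x : f (a *: x) = a *: f x. Proof. exact: linearZ. Qed.
End RawLinear.

(** Composition of maps that are only known to be linear through a proof. *)
Lemma linear_comp (K : fieldType) (U V W : lmodType K) (g : V -> W) (f : U -> V) :
  linear g -> linear f -> linear (fun x => g (f x)).
Proof. by move=> lg lf a x y; rewrite lf lg. Qed.

Section WordExt.
Variables (K : fieldType) (P : collection K) (n m : nat).

(** Words span T(P). *)
Lemma word_space_ext (V : lmodType K) (f g : T P n m -> V) :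
  linear f -> linear g ->
  (forall w, is_word n m w -> f (word n m w) = g (word n m w)) -> f =1 g.
Proof.
move=> lf lg e x.
have wE (u : word_index P n m) : gen (@word_rel K P n m) u = word n m (val u).
  rewrite /word; case: insubP => [v _ /val_inj -> //|]; by rewrite (valP u).
rewrite -[x]reprK -[repr x]freeg_sumE.
have piS (s : seq (word_index P n m)) (c : word_index P n m -> K) :
    \pi_(presented (@word_rel K P n m)) (\sum_(i <- s) << c i *g i >>) =
    \sum_(i <- s) c i *: word n m (val i).
  elim: s => [|i s IH].
    by rewrite !big_nil; have := linear_fun0 (@pi_presented_linear K _ (@word_rel K P n m)).
  rewrite !big_cons (@presented_piD K) IH -wE; congr (_ + _).
  rewrite -(linear_funZ (@pi_presented_linear K _ (@word_rel K P n m))).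
  congr (\pi_(_) _); apply/eqP/freeg_eqP => y.
  by rewrite coeffZ !coeffU mul1r.
rewrite piS (linear_fun_sum lf) (linear_fun_sum lg); apply: eq_bigr => u _.
by rewrite (linear_funZ lf) (linear_funZ lg) e //; exact: (valP u).
Qed.
End WordExt.

Section HomOperadLaws.
Variables (K : fieldType) (B : lmodType K).
Local Notation hl := (hletter B).
Local Notation hid := (hid B).
Implicit Types (p q : hl) (ps qs rs : seq hl) (s : seq B).

(** The values of the multilinear maps qs on consecutive groups of arguments. *)
Definition evals qs s : seq B :=
  [seq leval qb.1 qb.2 | qb <- zip qs (reshape (map (@arity _) qs) s)].

Lemma evals_cons q qs s :
  evals (q :: qs) s = leval q (take (arity q) s) :: evals qs (drop (arity q) s).
Proof. by []. Qed.

Lemma comp_evalE p qs s : comp_eval p qs s = leval p (evals qs s).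
Proof. by []. Qed.

Lemma size_evals qs s : size (evals qs s) = size qs.
Proof. by elim: qs s => //= q qs IH s; rewrite IH. Qed.

Lemma evals_cat qs rs s : evals (qs ++ rs) s =
  evals qs (take (arities qs) s) ++ evals rs (drop (arities qs) s).
Proof.
elim: qs s => [|q qs IH] s; first by rewrite drop0.
rewrite cat_cons !evals_cons IH /arities /= -/(arities qs).
by rewrite take_takel ?leq_addr // drop_drop take_drop [(arities qs + _)%N]addnC.
Qed.

Lemma hsize_le_arities qs : (size qs <= arities qs)%N.
Proof. by elim: qs => //= q qs IH; rewrite /arities /= addSn ltnS (leq_trans IH) ?leq_addl. Qed.

Lemma eq_mletter j (f g : seq B -> B) :
  (forall s, size s = j.-1.+1 -> f s = g s) -> mletter j f = mletter j g.
Proof.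
move=> e; rewrite /mletter.
suff -> : (fun t : j.-1.+1.-tuple B => f t) = (fun t => g t) by [].
by apply/funext => t; rewrite e ?size_tuple.
Qed.

Lemma mletter_leval p : mletter (arity p) (leval p) = p.
Proof.
case: p => k f; congr (Tagged _ _); rewrite /leval /=.
have -> : (fun t : k.+1.-tuple B => mlin_eval f t) = f.
  by apply/funext => t; rewrite /mlin_eval valK.
by apply: val_inj; rewrite /= insubdK //; exact: mlin_funP.
Qed.

Lemma leval_hcomp p qs s : (0 < arities qs)%N -> size s = arities qs ->
  leval (hcomp p qs) s = comp_eval p qs s.
Proof.
move=> a0 sz; rewrite /leval /= /mlin_eval; case: insubP => [t _ /= -> //|].
by rewrite sz prednK ?eqxx.
Qed.

Lemma arity_hcomp p qs : size qs = arity p -> arity (hcomp p qs) = arities qs.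
Proof.
move=> sz; rewrite /arity /= prednK //.
by apply: leq_trans (hsize_le_arities qs); rewrite sz.
Qed.

Lemma size_vcomp ps qs : size (vcomp ps qs) = size ps.
Proof. by elim: ps qs => //= p ps IH qs; rewrite IH. Qed.

Lemma size_take_arity p ps qs :
  size qs = arities (p :: ps) -> size (take (arity p) qs) = arity p.
Proof. by move=> sz; rewrite size_takel // sz leq_addr. Qed.

Lemma size_drop_arity p ps qs :
  size qs = arities (p :: ps) -> size (drop (arity p) qs) = arities ps.
Proof. by move=> sz; rewrite size_drop sz /arities /= addKn. Qed.

Lemma arities_vcomp ps qs :
  size qs = arities ps -> arities (vcomp ps qs) = arities qs.
Proof.
elim: ps qs => [|p ps IH] qs sz; first by case: qs sz.
rewrite -[in RHS](cat_take_drop (arity p) qs) arities_cat.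
rewrite /= -cat1s arities_cat IH ?(size_drop_arity sz) //.
by rewrite /arities /= addn0 arity_hcomp // (size_take_arity sz).
Qed.

Lemma evals_vcomp qs rs s : size rs = arities qs -> size s = arities rs ->
  evals (vcomp qs rs) s = evals qs (evals rs s).
Proof.
elim: qs rs s => [|q qs IH] rs s // szr szs.
have szt := size_take_arity szr; have szd := size_drop_arity szr.
have gt0 : (0 < arities (take (arity q) rs))%N.
  by apply: leq_trans (hsize_le_arities _); rewrite szt.
rewrite [vcomp _ _]/= evals_cons arity_hcomp //.
have szs' : size s = (arities (take (arity q) rs) + arities (drop (arity q) rs))%N.
  by rewrite -arities_cat cat_take_drop.
rewrite leval_hcomp //; last by rewrite size_takel // szs' leq_addr.
rewrite IH //; last by rewrite size_drop szs' addKn.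
rewrite comp_evalE evals_cons -[in RHS](cat_take_drop (arity q) rs) evals_cat.
have sz1 : size (evals (take (arity q) rs) (take (arities (take (arity q) rs)) s)) = arity q.
  by rewrite size_evals.
by rewrite (take_size_cat _ sz1) (drop_size_cat _ sz1).
Qed.

(** Associativity of the composition of multilinear maps. *)
Lemma hcompA p qs rs : size qs = arity p -> size rs = arities qs ->
  hcomp (hcomp p qs) rs = hcomp p (vcomp qs rs).
Proof.
move=> szq szr; rewrite [LHS]hcompE [RHS]hcompE arities_vcomp //; apply: eq_mletter => s.
have gtq : (0 < arities qs)%N by apply: leq_trans (hsize_le_arities _); rewrite szq.
have gtr : (0 < arities rs)%N by apply: leq_trans (hsize_le_arities _); rewrite szr.
rewrite prednK // => szs; rewrite !comp_evalE evals_vcomp // leval_hcomp //.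
by rewrite size_evals.
Qed.

(** Associativity of the vertical product on words. *)
Lemma vcompA ps qs rs : size qs = arities ps -> size rs = arities qs ->
  vcomp (vcomp ps qs) rs = vcomp ps (vcomp qs rs).
Proof.
elim: ps qs rs => //= p ps IH qs rs szq szr.
have szt := size_take_arity szq; have szd := size_drop_arity szq.
rewrite arity_hcomp //.
have szr' : size rs = (arities (take (arity p) qs) + arities (drop (arity p) qs))%N.
  by rewrite -arities_cat cat_take_drop.
have sz1 : size (take (arities (take (arity p) qs)) rs) = arities (take (arity p) qs).
  by rewrite size_takel // szr' leq_addr.
rewrite -[in RHS](cat_take_drop (arity p) qs) vcomp_cat.
have sz2 : size (vcomp (take (arity p) qs) (take (arities (take (arity p) qs)) rs)) = arity p.
  by rewrite size_vcomp.
rewrite take_size_cat // drop_size_cat // hcompA // IH //.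
by rewrite size_drop szr' addKn.
Qed.

Lemma leval_hid x : leval hid [:: x] = x.
Proof.
rewrite /leval /mlin_eval; case: insubP => //= t _ e.
by rewrite /thead (tnth_nth 0) e.
Qed.

Lemma arities_hid k : arities (nseq k hid) = k.
Proof. by elim: k => //= k IH; rewrite /arities /= -/(arities _) IH. Qed.

Lemma evals_hid s : evals (nseq (size s) hid) s = s.
Proof.
elim: s => //= x s IH; rewrite evals_cons /= take0 drop0 IH leval_hid //.
Qed.

Lemma hcomp_hidr p : hcomp p (nseq (arity p) hid) = p.
Proof.
rewrite hcompE arities_hid -[RHS]mletter_leval; apply: eq_mletter => s sz.
by rewrite comp_evalE -[arity p]sz evals_hid.
Qed.

Lemma hcomp_hidl q : hcomp hid [:: q] = q.
Proof.
rewrite hcompE {1}/arities /= addn0 -[RHS]mletter_leval; apply: eq_mletter => s sz.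
by rewrite comp_evalE evals_cons leval_hid take_oversize // sz.
Qed.

Lemma vcomp_hidr ps : vcomp ps (nseq (arities ps) hid) = ps.
Proof.
elim: ps => //= p ps IH; rewrite /arities /= -/(arities ps) nseqD.
by rewrite take_size_cat ?size_nseq // drop_size_cat ?size_nseq // hcomp_hidr IH.
Qed.

Lemma vcomp_hidl qs : vcomp (nseq (size qs) hid) qs = qs.
Proof. by elim: qs => //= q qs IH; rewrite take0 drop0 IH hcomp_hidl. Qed.

End HomOperadLaws.

Section Nabla.
Variables (K : fieldType) (B : lmodType K).
Local Notation TB := (T (homB B)).
Local Notation hid := (hid B).

Lemma nabla_tens_word n m k (ps qs : seq (hletter B)) :
  is_word n k ps -> is_word k m qs ->
  nabla_tens (word n k ps : TB n k) (word k m qs : TB k m) =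
  word n m (vcomp ps qs).
Proof.
move=> wp wq; rewrite /nabla_tens word_liftE //.
  rewrite word_liftE //.
  move=> w1 j w2 h; apply: (vcomp_linearr n m [::]).
  have /andP[_ /eqP ->] := wp; have /andP[/eqP + _] := h 0.
  by rewrite size_cat /= => <-; rewrite addnS ltnS leq_addr.
move=> w1 j w2 _ a p p'.
by apply: word_lift_fun => rs _; exact: (vcomp_linearl n m [::]).
Qed.

Lemma is_word_vcomp n k m (ps qs : seq (hletter B)) :
  is_word n k ps -> is_word k m qs -> is_word n m (vcomp ps qs).
Proof.
move=> /andP[/eqP sp /eqP ap] /andP[/eqP sq /eqP aq].
by rewrite /is_word size_vcomp sp arities_vcomp ?ap // aq !eqxx.
Qed.

Lemma nabla_tensA n k l m (x : TB n k) (y : TB k l) (z : TB l m) :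
  nabla_tens (nabla_tens x y) z = nabla_tens x (nabla_tens y z).
Proof.
move: x; apply: word_space_ext => [||ps wp].
- exact: linear_comp (nabla_linearl z) (nabla_linearl y).
- exact: nabla_linearl.
move: y; apply: word_space_ext => [||qs wq].
- exact: linear_comp (nabla_linearl z) (nabla_linearr _).
- exact: linear_comp (nabla_linearr _) (nabla_linearl z).
move: z; apply: word_space_ext => [||rs wr].
- exact: nabla_linearr.
- exact: linear_comp (nabla_linearr _) (nabla_linearr _).
rewrite !nabla_tens_word ?(is_word_vcomp wp wq) ?(is_word_vcomp wq wr) //.
move: wp wq wr => /andP[_ /eqP ap] /andP[/eqP sq /eqP aq] /andP[/eqP sr _].
by rewrite vcompA ?ap ?aq.
Qed.

Lemma is_word_hid n : is_word n n (nseq n hid).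
Proof. by rewrite /is_word size_nseq arities_hid !eqxx. Qed.

Lemma nabla_tens_unitr n m (x : TB n m) :
  nabla_tens x (word m m (nseq m hid)) = x.
Proof.
move: x; apply: (word_space_ext (f := fun x => nabla_tens x _)) => [||ps wp].
- exact: nabla_linearl.
- by [].
rewrite nabla_tens_word ?is_word_hid //.
by have /andP[_ /eqP <-] := wp; rewrite vcomp_hidr.
Qed.

Lemma nabla_tens_unitl n m (y : TB n m) :
  nabla_tens (word n n (nseq n hid)) y = y.
Proof.
move: y; apply: (word_space_ext (f := fun y => nabla_tens _ y)) => [||qs wq].
- exact: nabla_linearr.
- by [].
rewrite nabla_tens_word ?is_word_hid //.
by have /andP[/eqP <- _] := wq; rewrite vcomp_hidl.
Qed.

End Nabla.

(** * Convolution and half-shuffles *)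

Section NCWords.
Variable K : fieldType.
Local Notation TNC := (T (calNC K)).

Lemma is_word_basis n m (w : seq ncletter) :
  is_word n m (map (@basis_letter K NC) w) = is_word n m w.
Proof. by rewrite /is_word /arities size_map -map_comp. Qed.

Lemma span_coll_sum k (x : span_coll K NC k) :
  x = \sum_(y : NC k) x y *: ([ffun z => (z == y)%:R] : span_coll K NC k).
Proof.
apply/ffunP => z; rewrite sum_ffunE (bigD1 z) //= big1 => [|y ne].
  by rewrite addr0 !ffunE eqxx; rewrite [RHS]mulr1.
by rewrite !ffunE eq_sym (negPf ne); exact: mulr0.
Qed.

(** Words of partitions span T(NC). *)
Lemma TNC_ext (V : lmodType K) n m (f g : TNC n m -> V) :
  linear f -> linear g ->
  (forall w, is_word n m w -> f (nc_word K n m w) = g (nc_word K n m w)) ->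
  f =1 g.
Proof.
move=> lf lg e; apply: word_space_ext => // w hw.
suff H (pre : seq ncletter) :
    is_word n m (map (@basis_letter K NC) pre ++ w) ->
    f (word n m (map (@basis_letter K NC) pre ++ w)) =
    g (word n m (map (@basis_letter K NC) pre ++ w)) by exact: (H [::]).
elim: w pre {hw} => [|[k x] w IH] pre hw.
  by rewrite cats0 in hw *; apply: e; rewrite -is_word_basis.
pose h (x : calNC K k) :=
  word n m (map (@basis_letter K NC) pre ++ Tagged (fun k => calNC K k : Type) x :: w).
have lh : linear h by exact: word_linear.
rewrite -/(h x) [x]span_coll_sum (linear_fun_sum lh).
rewrite (linear_fun_sum lf) (linear_fun_sum lg); apply: eq_bigr => y _.
rewrite (linear_funZ lh) (linear_funZ lf) (linear_funZ lg); congr (_ *: _).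
have := IH (rcons pre (Tagged (fun n => NC n : Type) y)).
rewrite map_rcons cat_rcons; apply.
by rewrite -(is_word_letter n m _ x).
Qed.

Lemma size_le_arities (w : seq ncletter) : (size w <= arities w)%N.
Proof.
by elim: w => //= p w IH; rewrite /arities /= addSn ltnS (leq_trans IH) ?leq_addl.
Qed.

Lemma all_empty_arities (w : seq ncletter) :
  all (pred1 nc_empty) w = (size w == arities w).
Proof.
elim: w => //= p w IH; rewrite IH nc_emptyP /arities /= -/(arities w).
rewrite /arity addSn eqSS; case: (tag p) => [|k] //=.
apply/esym/negbTE; rewrite neq_ltn addSn ltnS.
by rewrite (leq_trans (size_le_arities w)) ?leq_addl.
Qed.

(** Words of empty partitions, that is, the words in T(NC)(n,n), have no half-cut. *)
Lemma word_half_cuts_empty b (w : seq ncletter) :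
  all (pred1 nc_empty) w -> word_half_cuts b w = [::].
Proof. by elim: w => //= p w IH /andP[-> /IH ->]. Qed.

End NCWords.

Section Hom2.
Variables (K : fieldType) (P Q : bicollection K).

Lemma hom2_addE (f g : hom2 P Q) n m x : (f + g) n m x = f n m x + g n m x.
Proof. by []. Qed.

Lemma hom2_linE s (f g : hom2 P Q) n m x :
  (s *: f + g) n m x = s *: f n m x + g n m x.
Proof. by []. Qed.
End Hom2.

Section Plus.
Variables (K : fieldType) (P : collection K) (Q : bicollection K).

Lemma Tproj_diag n (x : T P n n) : Tproj P n n x = 0.
Proof.
rewrite /= /Tproj_fun /Tplus; move: (eqxx n).
by case: (n == n).
Qed.

Lemma TinclK n m (x : Tplus P n m) : Tproj P n m (Tincl P n m x) = x.
Proof.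
move: x; rewrite /= /Tproj_fun /Tincl_fun /Tplus; case: (n == m) => // x.
by apply/rowP => -[].
Qed.

Lemma TprojK n m (x : T P n m) : n != m -> Tincl P n m (Tproj P n m x) = x.
Proof.
by rewrite /= /Tproj_fun /Tincl_fun /Tplus; case: (n == m).
Qed.

Lemma ext_zero_diag (f : hom2 (Tplus P) Q) n (x : T P n n) : ext_zero f n n x = 0.
Proof. by rewrite -[LHS]/(f n n (Tproj P n n x)) Tproj_diag linear0. Qed.

Lemma ext_zeroK (f : hom2 (Tplus P) Q) : comp2 (ext_zero f) (Tincl P) = f.
Proof. by apply: hom2P => n m x; rewrite -[in RHS](TinclK x). Qed.

Lemma ext_zero_inj : injective (@ext_zero K P Q).
Proof. by move=> f g e; rewrite -(ext_zeroK f) e ext_zeroK. Qed.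

Lemma ext_zero_linear : linear (@ext_zero K P Q).
Proof. by move=> a f g; apply: hom2P. Qed.

Lemma ext_zeroZ s (f : hom2 (Tplus P) Q) : ext_zero (s *: f) = s *: ext_zero f.
Proof. exact: (linear_funZ ext_zero_linear). Qed.

Lemma ext_zeroD (f g : hom2 (Tplus P) Q) :
  ext_zero (f + g) = ext_zero f + ext_zero g.
Proof. exact: (linear_funD ext_zero_linear). Qed.

End Plus.

Section Convolution.
Variables (K : fieldType) (B : unital_algebra K).
Local Notation TNC := (T (calNC K)).
Local Notation TB := (T (homB B)).
Implicit Types (f g h F : hom2 TNC TB) (a b : homPlus B).

Lemma homTNC_ext f g :
  (forall n m w, is_word n m w -> f n m (nc_word K n m w) = g n m (nc_word K n m w)) ->
  f = g.
Proof.
move=> e; apply: hom2P => n m; apply: TNC_ext => [||w hw]; last exact: e.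
- exact: hom2_linear.
- exact: hom2_linear.
Qed.

(** The contribution of a cut to the convolution of f and g. *)
Definition conv_term f g n m (c : seq ncletter * seq ncletter) : TB n m :=
  nabla_tens (f n (arities c.1) (nc_word K n (arities c.1) c.1))
             (g (arities c.1) m (nc_word K (arities c.1) m c.2)).

Lemma nabla_box_map f g n m k (x : TNC n k) (y : TNC k m) :
  nabla B n m (box_map f g n m (tens x y)) = nabla_tens (f n k x) (g k m y).
Proof.
rewrite /= /box_map_fun box_liftE; last 2 first.
- by move=> j q s u v; rewrite linearP (tens_linearl (g j m q)).
- by move=> j p s u v; rewrite linearP (tens_linearr (f n j p)).
rewrite /nabla_fun box_liftE //.
- by move=> j q; exact: nabla_linearl.
- by move=> j p; exact: nabla_linearr.
Qed.

Lemma conv_nc_word f g n m w : is_word n m w ->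
  conv f g n m (nc_word K n m w) = \sum_(c <- word_cuts w) conv_term f g n m c.
Proof.
move=> hw; rewrite -[LHS]/(nabla B n m (box_map f g n m
  (basis_lift (@coproduct_word K n m) (nc_word K n m w)))).
rewrite basis_liftE // /coproduct_word (linear_fun_sum (@hom2_linear K _ _ (box_map f g) n m)).
rewrite (linear_fun_sum (@hom2_linear K _ _ (nabla B) n m)); apply: eq_bigr => c _.
exact: nabla_box_map.
Qed.

(** The half-products are sums over half-cuts: the terms subtracted in the reduced
    half-coproducts have a factor in T(NC)(n,n), where morphisms extended by
    zero vanish. *)
Lemma half_conv_nc_word (t : bool) a b n m w : is_word n m w ->
  ext_zero (half_conv t a b) n m (nc_word K n m w) =
  \sum_(c <- word_half_cuts t w) conv_term (ext_zero a) (ext_zero b) n m c.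
Proof.
move=> hw; have [e|ne] := eqVneq n m.
  subst m; rewrite ext_zero_diag word_half_cuts_empty ?big_nil //.
  by have /andP[/eqP s1 /eqP s2] := hw; rewrite all_empty_arities s1 s2.
have -> : ext_zero (half_conv t a b) n m (nc_word K n m w) =
  nabla B n m (box_map (ext_zero a) (ext_zero b) n m
   (basis_lift (@half_coproduct_word K t n m) (Tincl _ n m (Tproj _ n m (nc_word K n m w))))).
  by [].
rewrite TprojK // basis_liftE // /half_coproduct_word.
pose N z := nabla B n m (box_map (ext_zero a) (ext_zero b) n m z).
have lN : linear N := linear_comp (@hom2_linear K _ _ (nabla B) n m) (@hom2_linear K _ _ (box_map _ _) n m).
rewrite -/(N _) (linear_funB lN) (linear_fun_sum lN).
rewrite [X in _ - X](_ : _ = 0) ?subr0.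
  by apply: eq_bigr => c _; exact: nabla_box_map.
case: t; rewrite /N nabla_box_map.
  by rewrite [ext_zero b _ _ _]ext_zero_diag (linear_fun0 (nabla_linearr _)).
by rewrite [ext_zero a _ _ _]ext_zero_diag (linear_fun0 (nabla_linearl _)).
Qed.

Lemma conv_term_linearl g n m c : linear (fun f => conv_term f g n m c).
Proof. by move=> s f f'; rewrite /conv_term /= (nabla_linearl _). Qed.

Lemma conv_term_linearr f n m c : linear (fun g => conv_term f g n m c).
Proof. by move=> s g g'; rewrite /conv_term /= (nabla_linearr _). Qed.

Lemma conv_linearl g : linear (fun f => conv f g).
Proof.
move=> s f f'; apply: homTNC_ext => n m w hw; rewrite conv_nc_word //.
rewrite hom2_linE.
rewrite !conv_nc_word // scaler_sumr -big_split; apply: eq_bigr => c _.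
exact: conv_term_linearl.
Qed.

Lemma conv_linearr f : linear (conv f).
Proof.
move=> s g g'; apply: homTNC_ext => n m w hw; rewrite conv_nc_word //.
rewrite hom2_linE.
rewrite !conv_nc_word // scaler_sumr -big_split; apply: eq_bigr => c _.
exact: conv_term_linearr.
Qed.

Lemma half_conv_linearl t b : linear (fun a => half_conv t a b).
Proof.
move=> s a a'; apply: ext_zero_inj; rewrite ext_zero_linear.
apply: homTNC_ext => n m w hw; rewrite half_conv_nc_word // ext_zero_linear.
rewrite hom2_linE.
rewrite !half_conv_nc_word // scaler_sumr -big_split; apply: eq_bigr => c _.
exact: conv_term_linearl.
Qed.

Lemma half_conv_linearr t a : linear (half_conv t a).
Proof.
move=> s b b'; apply: ext_zero_inj; rewrite ext_zero_linear.
apply: homTNC_ext => n m w hw; rewrite half_conv_nc_word // ext_zero_linear.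
rewrite hom2_linE.
rewrite !half_conv_nc_word // scaler_sumr -big_split; apply: eq_bigr => c _.
exact: conv_term_linearr.
Qed.

(** The contribution of a triple of words to a product of three factors. *)
Definition conv_triple f g h n m (x y z : seq ncletter) : TB n m :=
  nabla_tens (nabla_tens (f n (arities x) (nc_word K n (arities x) x))
                         (g (arities x) (arities y) (nc_word K (arities x) (arities y) y)))
             (h (arities y) m (nc_word K (arities y) m z)).

(** A product whose left factor is itself a sum over cuts is a sum over nested
    cuts. *)
Lemma conv_terml_sum F f g h n m c (D : seq (seq ncletter * seq ncletter)) :
  {subset D <= word_cuts c.1} ->
  F n (arities c.1) (nc_word K n (arities c.1) c.1) =
    \sum_(d <- D) conv_term f g n (arities c.1) d ->
  conv_term F h n m c = \sum_(d <- D) conv_triple f g h n m d.1 d.2 c.2.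
Proof.
move=> sD e; rewrite /conv_term e (linear_fun_sum (nabla_linearl _)).
apply: eq_big_seq => d /sD /word_cuts_arity[_ _ <-].
by [].
Qed.

Lemma conv_termr_sum F f g h n m c (D : seq (seq ncletter * seq ncletter)) :
  F (arities c.1) m (nc_word K (arities c.1) m c.2) =
    \sum_(d <- D) conv_term g h (arities c.1) m d ->
  conv_term f F n m c = \sum_(d <- D) conv_triple f g h n m c.1 d.1 d.2.
Proof.
move=> e; rewrite /conv_term e (linear_fun_sum (nabla_linearr _)).
by apply: eq_bigr => d _; rewrite /conv_triple nabla_tensA.
Qed.

Lemma is_word_cut n m w c : is_word n m w -> c \in word_cuts w ->
  is_word n (arities c.1) c.1 /\ is_word (arities c.1) m c.2.
Proof.
move=> /andP[/eqP sw /eqP aw] /word_cuts_arity[s1 s2 a2].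
by rewrite /is_word s1 s2 a2 sw aw !eqxx.
Qed.

Lemma convA f g h : conv (conv f g) h = conv f (conv g h).
Proof.
apply: homTNC_ext => n m w hw; rewrite !conv_nc_word //.
transitivity (\sum_(c <- word_cuts w) \sum_(d <- word_cuts c.1)
   conv_triple f g h n m d.1 d.2 c.2).
  apply: eq_big_seq => c hc; apply: conv_terml_sum => //.
  by have [h1 _] := is_word_cut hw hc; rewrite conv_nc_word.
rewrite (word_coassoc w (conv_triple f g h n m)).
apply: eq_big_seq => c hc; symmetry; apply: conv_termr_sum.
by have [_ h2] := is_word_cut hw hc; rewrite conv_nc_word.
Qed.

Lemma conv_ext_nc_word a b n m w : is_word n m w ->
  ext_zero (hprec a b + hsucc a b) n m (nc_word K n m w) =
  \sum_(c <- word_cuts w) conv_term (ext_zero a) (ext_zero b) n m c.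
Proof.
move=> hw; rewrite sum_word_cuts_split.
rewrite ext_zeroD hom2_addE.
rewrite !half_conv_nc_word //; case: ifP => ae; last by rewrite addr0.
have e : arities w = n.
  by move: ae hw; rewrite all_empty_arities => /eqP <- /andP[/eqP].
rewrite /conv_term -[(w, w).1]/w e ext_zero_diag.
by rewrite (linear_fun0 (nabla_linearl _)) addr0.
Qed.

Lemma conv_ext a b : conv (ext_zero a) (ext_zero b) = ext_zero (hprec a b + hsucc a b).
Proof.
by apply: homTNC_ext => n m w hw; rewrite conv_nc_word // conv_ext_nc_word.
Qed.

Lemma hprec_hprec a b (c : homPlus B) : hprec (hprec a b) c = hprec a (hprec b c + hsucc b c).
Proof.
apply: ext_zero_inj; apply: homTNC_ext => n m w hw; rewrite !half_conv_nc_word //.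
transitivity (\sum_(x <- word_half_cuts true w) \sum_(y <- word_half_cuts true x.1)
   conv_triple (ext_zero a) (ext_zero b) (ext_zero c) n m y.1 y.2 x.2).
  apply: eq_big_seq => x /word_half_cuts_sub hx; apply: conv_terml_sum.
    exact: word_half_cuts_sub.
  by have [h1 _] := is_word_cut hw hx; rewrite half_conv_nc_word.
rewrite (half_coassoc_fst w (conv_triple _ _ _ n m)).
apply: eq_big_seq => x /word_half_cuts_sub hx; symmetry; apply: conv_termr_sum.
by have [_ h2] := is_word_cut hw hx; rewrite conv_ext_nc_word.
Qed.

Lemma hprec_hsucc a b (c : homPlus B) : hprec (hsucc a b) c = hsucc a (hprec b c).
Proof.
apply: ext_zero_inj; apply: homTNC_ext => n m w hw; rewrite !half_conv_nc_word //.
transitivity (\sum_(x <- word_half_cuts true w) \sum_(y <- word_half_cuts false x.1)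
   conv_triple (ext_zero a) (ext_zero b) (ext_zero c) n m y.1 y.2 x.2).
  apply: eq_big_seq => x /word_half_cuts_sub hx; apply: conv_terml_sum.
    exact: word_half_cuts_sub.
  by have [h1 _] := is_word_cut hw hx; rewrite half_conv_nc_word.
rewrite (half_coassoc_mid w (conv_triple _ _ _ n m)).
apply: eq_big_seq => x /word_half_cuts_sub hx; symmetry; apply: conv_termr_sum.
by have [_ h2] := is_word_cut hw hx; rewrite half_conv_nc_word.
Qed.

Lemma hsucc_hsucc a b (c : homPlus B) : hsucc a (hsucc b c) = hsucc (hsucc a b + hprec a b) c.
Proof.
apply: ext_zero_inj; apply: homTNC_ext => n m w hw; rewrite !half_conv_nc_word //.
symmetry.
transitivity (\sum_(x <- word_half_cuts false w) \sum_(y <- word_cuts x.1)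
   conv_triple (ext_zero a) (ext_zero b) (ext_zero c) n m y.1 y.2 x.2).
  apply: eq_big_seq => x /word_half_cuts_sub hx; apply: conv_terml_sum => //.
  by have [h1 _] := is_word_cut hw hx; rewrite addrC conv_ext_nc_word.
rewrite (half_coassoc_lst w (conv_triple _ _ _ n m)).
apply: eq_big_seq => x /word_half_cuts_sub hx; symmetry; apply: conv_termr_sum.
by have [_ h2] := is_word_cut hw hx; rewrite half_conv_nc_word.
Qed.

Lemma shuffle_homPlus : shuffle_algebra (@hprec K B) (@hsucc K B).
Proof.
split.
- exact: half_conv_linearl.
- exact: half_conv_linearr.
- exact: half_conv_linearl.
- exact: half_conv_linearr.
- exact: hprec_hprec.
- exact: hprec_hsucc.
- exact: hsucc_hsucc.
Qed.

Lemma vcoef_vone n m : vcoef (vone K n m) = (n == m)%:R.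
Proof. by rewrite /vcoef /vone /vunit; case: (n == m). Qed.

Lemma unit_conv_nc_word n m w : is_word n m w ->
  unit_conv B n m (nc_word K n m w) =
  if all (pred1 nc_empty) w then word n m (nseq n (hid B)) else 0.
Proof.
move=> hw; rewrite /= basis_liftE // /eta_fun /counit_word all_empty_arities.
have /andP[/eqP -> /eqP ->] := hw.
case: ifP => [nm|_]; first by rewrite vcoef_vone nm scale1r.
by rewrite (linear_fun0 (@vcoef_linear K n m)) scale0r.
Qed.

Lemma conv_unitr f : conv f (unit_conv B) = f.
Proof.
apply: homTNC_ext => n m w hw; rewrite conv_nc_word //.
pose F (c : seq ncletter * seq ncletter) : TB n m :=
  nabla_tens (f n (arities c.1) (nc_word K n (arities c.1) c.1))
             (word (arities c.1) m (nseq (arities c.1) (hid B))).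
transitivity (\sum_(c <- word_cuts w) if all (pred1 nc_empty) c.2 then F c else 0).
  apply: eq_big_seq => c hc; have [_ h2] := is_word_cut hw hc.
  rewrite /conv_term unit_conv_nc_word //; case: ifP => // _.
  exact: linear_fun0 (nabla_linearr _).
rewrite sum_word_cuts_counitr /F /=.
by have /andP[_ /eqP ->] := hw; rewrite nabla_tens_unitr.
Qed.

Lemma conv_unitl f : conv (unit_conv B) f = f.
Proof.
apply: homTNC_ext => n m w hw; rewrite conv_nc_word //.
pose F (c : seq ncletter * seq ncletter) : TB n m :=
  nabla_tens (word n (arities c.1) (nseq n (hid B)))
             (f (arities c.1) m (nc_word K (arities c.1) m c.2)).
transitivity (\sum_(c <- word_cuts w) if all (pred1 nc_empty) c.1 then F c else 0).
  apply: eq_big_seq => c hc; have [h1 _] := is_word_cut hw hc.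
  rewrite /conv_term unit_conv_nc_word //; case: ifP => // _.
  exact: linear_fun0 (nabla_linearl _).
rewrite sum_word_cuts_counitl /F /=.
have -> : arities (nseq (size w) nc_empty) = n.
  have := all_empty_arities (nseq (size w) nc_empty).
  rewrite all_nseq /= eqxx orbT size_nseq => /esym/eqP <-.
  by have /andP[/eqP ->] := hw.
by rewrite nabla_tens_unitl.
Qed.

(** This holds even when B = 0, T(Hom(B))(0,0) being spanned by the empty word. *)
Lemma word00_neq0 : word 0 0 [::] != 0 :> TB 0 0.
Proof.
have l : letter_linear 0 0 (fun _ : seq (hletter B) => 1 : K^o).
  by move=> w1 k w2 h; have := h 0; rewrite /is_word size_cat addnS.
apply/eqP => e; have := word_liftE (n := 0) (m := 0) l (w := [::]) isT.
rewrite e (linear_fun0 (word_lift_linear l)) => /esym/eqP.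
by rewrite oner_eq0.
Qed.

Lemma homBar_mor_linear : linear (@homBar_mor K B).
Proof.
move=> s [x a] [y b]; rewrite /homBar_mor /= ext_zero_linear scalerDl scalerDr.
by rewrite -!scalerA addrACA.
Qed.

Lemma homBar_mor_inj : injective (@homBar_mor K B).
Proof.
suff H (x : homBar B) : homBar_mor x = 0 -> x = 0.
  move=> x y e; apply/eqP; rewrite -subr_eq0; apply/eqP/H.
  have := homBar_mor_linear (-1) y x; rewrite e !scaleN1r addNr => <-.
  by rewrite addrC.
case: x => x a; rewrite /homBar_mor /= => e.
have x0 : x = 0.
  have : ((x : K) *: unit_conv B + ext_zero a) 0 0 (nc_word K 0 0 [::]) = 0.
    by rewrite e.
  rewrite hom2_linE unit_conv_nc_word // ext_zero_diag addr0 /=.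
  by move/eqP; rewrite scaler_eq0 (negPf word00_neq0) orbF => /eqP.
move: e; rewrite x0 scale0r add0r => e.
suff -> : a = 0 by [].
by apply: ext_zero_inj; rewrite e (linear_fun0 (@ext_zero_linear K _ _)).
Qed.

Lemma homBar_mor_one : homBar_mor (aug_one (homPlus B)) = unit_conv B.
Proof.
by rewrite /homBar_mor /= scale1r (linear_fun0 (@ext_zero_linear K _ _)) addr0.
Qed.

(** The convolution product read on pairs (c, f). *)
Definition star (x y : homBar B) : homBar B :=
  ((x.1 : K) * y.1, x.1 *: y.2 + y.1 *: x.2 + (hprec x.2 y.2 + hsucc x.2 y.2)).

Lemma homBar_mor_star x y : homBar_mor (star x y) = conv (homBar_mor x) (homBar_mor y).
Proof.
case: x y => [x a] [y b]; rewrite /star /homBar_mor /=.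
rewrite (conv_linearl _) !(linear_funD (conv_linearr _)) !(linear_funZ (conv_linearr _)).
rewrite conv_unitl conv_unitr conv_unitl conv_ext ext_zeroD ext_zero_linear ext_zeroZ.
by rewrite scalerDr scalerA !addrA.
Qed.

Lemma star_linearl y : linear (star^~ y).
Proof.
move=> s x x'; apply: homBar_mor_inj; rewrite homBar_mor_linear !homBar_mor_star.
by rewrite homBar_mor_linear; exact: conv_linearl.
Qed.

Lemma star_linearr x : linear (star x).
Proof.
move=> s y y'; apply: homBar_mor_inj; rewrite homBar_mor_linear !homBar_mor_star.
by rewrite homBar_mor_linear; exact: conv_linearr.
Qed.

Lemma starA : associative star.
Proof. by move=> x y z; apply: homBar_mor_inj; rewrite !homBar_mor_star convA. Qed.

Lemma star1l : left_id (aug_one (homPlus B)) star.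
Proof.
by move=> x; apply: homBar_mor_inj; rewrite homBar_mor_star homBar_mor_one conv_unitl.
Qed.

Lemma star1r : right_id (aug_one (homPlus B)) star.
Proof.
by move=> x; apply: homBar_mor_inj; rewrite homBar_mor_star homBar_mor_one conv_unitr.
Qed.

Lemma augmented_shuffle_homBar :
  augmented_shuffle_algebra (@hprec K B) (@hsucc K B)
    (@bar_prec K B) (@bar_succ K B) star.
Proof.
have prec0 a : hprec 0 a = 0 := linear_fun0 (half_conv_linearl true a).
have prec0r a : hprec a 0 = 0 := linear_fun0 (half_conv_linearr true a).
have succ0 a : hsucc 0 a = 0 := linear_fun0 (half_conv_linearl false a).
have succ0r a : hsucc a 0 = 0 := linear_fun0 (half_conv_linearr false a).
split.
- exact: shuffle_homPlus.
- exact: star_linearl.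
- exact: star_linearr.
- exact: starA.
- exact: star1l.
- exact: star1r.
- by move=> a b; rewrite /star /aug_in /= mul0r !scale0r !add0r.
- by move=> a b; rewrite /bar_prec /= mul0r eqxx scale0r add0r.
- by move=> a b; rewrite /bar_succ /= mul0r eqxx scale0r add0r.
- by move=> a; rewrite /bar_prec /= mul0r eqxx scale1r prec0r addr0.
- by move=> a; rewrite /bar_prec /= mulr0 eqxx scale0r prec0 addr0.
- by move=> a; rewrite /bar_succ /= mulr0 eqxx scale1r succ0 addr0.
- by move=> a; rewrite /bar_succ /= mul0r eqxx scale0r succ0r addr0.
- by rewrite /bar_prec /= mul1r oner_eq0.
- by rewrite /bar_succ /= mul1r oner_eq0.
Qed.

End Convolution.

Theorem proposition28 (R : realType) (B : unital_algebra R[i]) :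
  [/\ injective (@homBar_mor R[i] B),
      homBar_mor (aug_one (homPlus B)) = unit_conv B
    & exists2 star : homBar B -> homBar B -> homBar B,
        forall f g : homBar B,
          homBar_mor (star f g) = conv (homBar_mor f) (homBar_mor g)
      & augmented_shuffle_algebra (@hprec R[i] B) (@hsucc R[i] B)
          (@bar_prec R[i] B) (@bar_succ R[i] B) star].
Proof.
split; [exact: homBar_mor_inj | exact: homBar_mor_one |].
exists (@star _ B); [exact: homBar_mor_star | exact: augmented_shuffle_homBar].
Qed.
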